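(* Let $T>0$ and let $a_0,a_1,a_2:\mathbb{R}\to\mathbb{R}$ be smooth $T$-periodic functions with $a_2(t)\ne0$ for all $t\in\mathbb{R}$. Consider the Riccati equation $$x'=a_2(t)x^2+a_1(t)x+a_0(t)$$ and define the $T$-periodic function $$\gamma(t)=a_2(t)a_0(t)-A(t)^2+A'(t),\qquad A(t)=\frac12\Big(a_1(t)+\frac{a_2'(t)}{a_2(t)}\Big).$$ Let $\Delta_\gamma$ be the discriminant associated with $\gamma$. If $\Delta_\gamma>0$, then the equation $x'=a_2(t)x^2+a_1(t)x+a_0(t)$ has exactly two limit cycles and both are hyperbolic; if $\Delta_\gamma=0$, it has a unique limit cycle, which is semi-stable and double; and if $\Delta_\gamma<0$, it has no limit cycles. Moreover, $\underline{\mu}[\gamma](p)-\overline{\gamma}\le\Delta_\gamma\le\overline{\mu}[\gamma](q)-\overline{\gamma}$ for every $p\in\mathcal{C}^1_T(\mathbb{R})$ and every $q\in\mathcal{C}^1_{T,0}(\mathbb{R})$.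
   Context: $\mathcal{C}^1_T(\mathbb{R})$ denotes the space of $T$-periodic $\mathcal{C}^1$ real functions on $\mathbb{R}$, and $\mathcal{C}^1_{T,0}(\mathbb{R})$ the subspace of those with zero average over $[0,T]$. For $\gamma\in\mathcal{C}^1_T(\mathbb{R})$ put $\overline{\gamma}:=\frac1T\int_0^T\gamma(t)\,dt$ and $\widehat{\gamma}(t):=\gamma(t)-\overline{\gamma}$, and define $$\underline{\mu}[\gamma](p):=-\max_{t\in[0,T]}\{p(t)^2+\widehat{\gamma}(t)-p'(t)\},\qquad p\in\mathcal{C}^1_T(\mathbb{R}),$$ $$\overline{\mu}[\gamma](p):=\Big(\int_0^T e^{-2\int_0^t p(s)\,ds}\,dt\Big)^{-1}\int_0^T e^{-2\int_0^t p(s)\,ds}\big(p(t)^2-\widehat{\gamma}(t)\big)\,dt,\qquad p\in\mathcal{C}^1_{T,0}(\mathbb{R}).$$ The number $\gamma^*:=\max\{\underline{\mu}[\gamma](p):p\in\mathcal{C}^1_T(\mathbb{R})\}$ exists and equals $\min\{\overline{\mu}[\gamma](p):p\in\mathcal{C}^1_{T,0}(\mathbb{R})\}$. The discriminant associated with $\gamma$ is $\Delta_\gamma:=\gamma^*-\overline{\gamma}$. For a $T$-periodic equation $x'=f(t,x)$, a limit cycle is an isolated $T$-periodic solution. The displacement map sends an initial value $x_0$ at $t=0$ to $x(T;x_0)-x_0$, where $x(\cdot;x_0)$ is the solution with $x(0;x_0)=x_0$ (where defined up to time $T$). A limit cycle $\phi$ is hyperbolic if $\phi(0)$ is a simple zero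 of the displacement map, equivalently $\int_0^T\frac{\partial f}{\partial x}(t,\phi(t))\,dt\neq0$. It is double if $\phi(0)$ is a zero of multiplicity exactly $2$ of the displacement map. It is semi-stable if it attracts nearby solutions from one side and repels them from the other. *)

(* Defs.v *)
(* Stdlib reals with Coquelicot. *)
From Stdlib Require Import Reals.
From Coquelicot Require Import Coquelicot.
Open Scope R_scope.

Definition is_max (E : R -> Prop) (m : R) : Prop :=
  E m /\ forall y, E y -> y <= m.

(* Meaningful only when [E] has a maximum; see [set_max_correct]. *)
Definition set_max (E : R -> Prop) : R :=
  iota (T := R_CompleteSpace) (is_max E).

Lemma set_max_correct (E : R -> Prop) (m : R) : is_max E m -> is_max E (set_max E).
Proof.
intros Hm; apply (@iota_correct _ R_CompleteNormedModule (is_max E)).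
exists m; split; [exact Hm|].
intros y [Ey Hy]; destruct Hm as [Em Hm].
now apply Rle_antisym; [apply Hy | apply Hm].
Qed.

Definition periodic (T : R) (f : R -> R) : Prop := forall t, f (t + T) = f t.

Definition smooth (f : R -> R) : Prop := forall (n : nat) (t : R), ex_derive_n f n t.

Definition average (T : R) (f : R -> R) : R := / T * RInt f 0 T.

Definition centered (T : R) (f : R -> R) (t : R) : R := f t - average T f.

Definition C1_per (T : R) (p : R -> R) : Prop :=
  periodic T p /\
  (forall t, ex_derive p t) /\ (forall t, continuous (Derive p) t).

Definition C1_per0 (T : R) (p : R -> R) : Prop := C1_per T p /\ average T p = 0.

Definition mu_low (T : R) (gamma p : R -> R) : R :=
  - set_max (fun y => exists t, 0 <= t <= T /\
                 y = (p t) ^ 2 + centered T gamma t - Derive p t).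

Definition mu_up (T : R) (gamma p : R -> R) : R :=
  / RInt (fun t => exp (- 2 * RInt p 0 t)) 0 T *
  RInt (fun t => exp (- 2 * RInt p 0 t) * ((p t) ^ 2 - centered T gamma t)) 0 T.

Definition gamma_star (T : R) (gamma : R -> R) : R :=
  set_max (fun y => exists p, C1_per T p /\ y = mu_low T gamma p).

Definition discriminant (T : R) (gamma : R -> R) : R :=
  gamma_star T gamma - average T gamma.

(* [x] solves x' = f(t,x) on [I]. Derivatives are two-sided also at the
   endpoints of [I]: for continuous [f] a solution on a closed interval extends
   differentiably past its endpoints, so this is no restriction. *)
Definition solves_on (f : R -> R -> R) (I : R -> Prop) (x : R -> R) : Prop :=
  forall t, I t -> is_derive x t (f t (x t)).

Definition periodic_solution (f : R -> R -> R) (T : R) (x : R -> R) : Prop :=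
  solves_on f (fun _ => True) x /\ periodic T x.

(* Isolated, for the uniform distance, among the T-periodic solutions. *)
Definition limit_cycle (f : R -> R -> R) (T : R) (phi : R -> R) : Prop :=
  periodic_solution f T phi /\
  exists eps, 0 < eps /\
    forall psi, periodic_solution f T psi ->
      (forall t, Rabs (psi t - phi t) < eps) -> psi = phi.

Definition displacement_rel (f : R -> R -> R) (T x0 d : R) : Prop :=
  exists x, solves_on f (fun t => 0 <= t <= T) x /\ x 0 = x0 /\ d = x T - x0.

Definition displacement_dom (f : R -> R -> R) (T x0 : R) : Prop :=
  exists d, displacement_rel f T x0 d.

(* Meaningful only on [displacement_dom], where [d] is unique if [f] is
   locally Lipschitz in x. *)
Definition displacement (f : R -> R -> R) (T x0 : R) : R :=
  iota (T := R_CompleteSpace) (displacement_rel f T x0).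

(* The clause j = 0 says that [g x = 0]. *)
Definition zero_of_mult (g : R -> R) (x : R) (k : nat) : Prop :=
  locally x (fun y => forall j, (j <= k)%nat -> ex_derive_n g j y) /\
  (forall j, (j < k)%nat -> Derive_n g j x = 0) /\
  Derive_n g k x <> 0.

Definition cycle_of_mult (f : R -> R -> R) (T : R) (phi : R -> R) (k : nat) : Prop :=
  locally (phi 0) (displacement_dom f T) /\
  zero_of_mult (displacement f T) (phi 0) k.

Definition hyperbolic (f : R -> R -> R) (T : R) (phi : R -> R) : Prop :=
  cycle_of_mult f T phi 1.

Definition double_cycle (f : R -> R -> R) (T : R) (phi : R -> R) : Prop :=
  cycle_of_mult f T phi 2.

(* The sign s = 1 (resp. -1) selects the side above (resp. below) [phi]. *)
Definition attracts_side (f : R -> R -> R) (phi : R -> R) (s : R) : Prop :=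
  exists eps, 0 < eps /\
    forall x0, 0 < s * (x0 - phi 0) < eps ->
      exists x, solves_on f (fun t => 0 <= t) x /\ x 0 = x0 /\
        is_lim (fun t => x t - phi t) p_infty 0.

(* Solutions starting arbitrarily close to [phi] on the given side all move
   away to a fixed distance; they need not exist for all positive times. *)
Definition repels_side (f : R -> R -> R) (phi : R -> R) (s : R) : Prop :=
  exists eps, 0 < eps /\
    forall x0, 0 < s * (x0 - phi 0) < eps ->
      exists b x, 0 <= b /\ solves_on f (fun t => 0 <= t <= b) x /\ x 0 = x0 /\
        eps <= Rabs (x b - phi b).

Definition semi_stable (f : R -> R -> R) (phi : R -> R) : Prop :=
  exists s, (s = 1 \/ s = -1) /\ attracts_side f phi s /\ repels_side f phi (- s).

Definition riccati (a0 a1 a2 : R -> R) (t x : R) : R :=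
  a2 t * x ^ 2 + a1 t * x + a0 t.

Definition riccati_A (a1 a2 : R -> R) (t : R) : R :=
  1 / 2 * (a1 t + Derive a2 t / a2 t).

Definition riccati_gamma (a0 a1 a2 : R -> R) (t : R) : R :=
  a2 t * a0 t - (riccati_A a1 a2 t) ^ 2 + Derive (riccati_A a1 a2) t.

(* Main.v *)
Require Import Defs.
From Stdlib Require Import Reals ZArith Lra Lia Psatz.
From Stdlib Require Import FunctionalExtensionality ClassicalEpsilon.
From Coquelicot Require Import Coquelicot.
Open Scope R_scope.

(** The substitution [y = a2 x + A] carries the equation to the normal form
    [y' = y^2 + gamma], periodic solutions to periodic solutions. Write [gamma] as
    its centered part [g] plus its average and let a parameter [lam] replace the
    average: [y' = y^2 + g + lam].

    Call [p] an upper solution for [lam] if it is periodic with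
    [p' >= p^2 + g + lam]; thus [mu_low p] is the largest [lam] for which [p] is an
    upper solution, and [gamma_star] asks for the largest [lam] which admits one.
    An upper solution forces a periodic solution below it, indeed a least one
    ([minimal_solution]), which is the monotone limit of solutions of linear periodic
    problems. Least solutions increase with [lam], so they converge as [lam]
    increases to the supremum, and the supremum is attained by some periodic solution
    [phi]. Its mean is zero: otherwise the linearization of the equation at [phi] is
    invertible among periodic functions, and moving [phi] along the periodic solution
    of [z' = 2 phi z + 1] gives an upper solution for a larger parameter
    ([principal_solution]).

    A zero-mean solution [phi] determines everything else. For a periodic [q] of zero
    mean put [w = exp (- 2 int q)]. If [p] is an upper solution for [mu], then
[[
      (w p)' >= w (p - q)^2 - w (q^2 - g) + mu w .
]]
    Integrated over a period, with [q = phi] this bounds every such [mu] by the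
    parameter of [phi], and with [p = phi] it is the lower bound on [mu_up q]. Hence
    [gamma_star] is the parameter of [phi], and the sign of the discriminant tells
    whether [y' = y^2 + gamma] has a periodic solution of nonzero mean, of zero mean,
    or none ([discriminant_trichotomy]).

    It remains to count solutions of [x' = a2 x^2 + a1 x + a0] from one periodic
    solution [phi]. The difference [z] to [phi] satisfies a Bernoulli equation, so
    every solution is explicit:
[[
      z(t) = z0 E(t) / (1 - z0 F(t)),  E = exp (int (2 a2 phi + a1)),  F = int a2 E .
]]
    The displacement map is therefore a Moebius map minus the identity. With
    [M = E(T)] it has the two simple zeros [0] and [(1 - M) / F(T)] if [M <> 1], and
    the double zero [0] alone if [M = 1]; in the latter case [E] is periodic while
    [F] is unbounded, so that one side of [phi] is attracted and the other escapes.
    Finally [M = exp (2 int y)] for the solution [y] in normal form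
    ([growth_of_solution]), which links [M <> 1] to a nonzero mean. *)

(** * Calculus preliminaries *)

Lemma is_derive_eq (f : R -> R) (x l l' : R) :
  is_derive f x l -> l = l' -> is_derive f x l'.
Proof. intros H <-; exact H. Qed.

(** [auto_derive] leaves the derivatives of abstract functions as terms [Derive h t];
    this replaces one of them by the value that [H] provides. *)
Ltac derive_known H :=
  let P := type of H in
  match P with
  | is_derive ?f ?t ?l =>
      match goal with
      | |- context [Derive ?h t] =>
          replace (Derive h t) with l by (symmetry; exact (is_derive_unique f t l H))
      end
  end.

Lemma is_derive_continuous (f : R -> R) (x l : R) : is_derive f x l -> continuous f x.
Proof. intros H; apply (ex_derive_continuous f); now exists l. Qed.

Lemma mean_value (f df : R -> R) (a b : R) :
  (forall t, Rmin a b <= t <= Rmax a b -> is_derive f t (df t)) ->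
  exists c, Rmin a b <= c <= Rmax a b /\ f b - f a = df c * (b - a).
Proof.
intros H; apply MVT_gen.
- intros t Ht; apply H; lra.
- intros t Ht; apply continuity_pt_filterlim.
  exact (is_derive_continuous _ _ _ (H t Ht)).
Qed.

Lemma is_derive_nonneg_incr (f df : R -> R) (a b : R) :
  (forall t, a <= t <= b -> is_derive f t (df t)) ->
  (forall t, a <= t <= b -> 0 <= df t) -> a <= b -> f a <= f b.
Proof.
intros H Hd Hab.
destruct (mean_value f df a b) as [c [Hc E]].
{ rewrite Rmin_left, Rmax_right by lra; exact H. }
rewrite Rmin_left, Rmax_right in Hc by lra.
specialize (Hd c Hc); nra.
Qed.

Lemma is_derive_zero_const (f : R -> R) :
  (forall t, is_derive f t 0) -> forall s t, f s = f t.
Proof.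
intros H s t.
destruct (mean_value f (fun _ => 0) s t) as [c [_ E]]; [now intros; apply H|lra].
Qed.

Lemma is_derive_primitive (b : R -> R) (t : R) :
  (forall s, continuous b s) -> is_derive (fun x => RInt b 0 x) t (b t).
Proof.
intros Hb; apply (is_derive_RInt b _ 0); [|apply Hb].
apply filter_forall; intros x; apply (@RInt_correct R_CompleteNormedModule).
now apply (@ex_RInt_continuous R_CompleteNormedModule); intros; apply Hb.
Qed.

Lemma RInt_of_derive (f df : R -> R) (a b : R) :
  (forall t, is_derive f t (df t)) -> (forall t, continuous df t) ->
  RInt df a b = f b - f a.
Proof.
intros H Hc; apply is_RInt_unique; apply (is_RInt_derive f df); auto.
Qed.

Lemma RInt_point_R (f : R -> R) (a : R) : RInt f a a = 0.
Proof. exact (RInt_point a f). Qed.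

Lemma is_derive_shift (f : R -> R) (T t l : R) :
  is_derive f (t + T) l -> is_derive (fun x => f (x + T)) t l.
Proof.
intros H.
apply is_derive_eq with (scal 1 l); [|exact (Rmult_1_l l)].
apply (is_derive_comp f (fun x => x + T) t); [exact H|].
auto_derive; [easy|ring].
Qed.

(** * Periodic functions *)

Lemma periodic_translate (T : R) (f : R -> R) (t : R) (n : Z) :
  periodic T f -> f (t + IZR n * T) = f t.
Proof.
intros Hf.
assert (Hn : forall m s, f (s + INR m * T) = f s).
{ induction m as [|m IH]; intros s.
  - f_equal; simpl; ring.
  - rewrite S_INR; replace (s + (INR m + 1) * T) with ((s + INR m * T) + T) by ring.
    now rewrite Hf. }
destruct n as [|n|n].
- f_equal; ring.
- rewrite <- (positive_nat_Z n), <- INR_IZR_INZ; apply Hn.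
- rewrite <- (Hn (Pos.to_nat n) (t + _)).
  rewrite INR_IZR_INZ, positive_nat_Z, <- Pos2Z.opp_pos, opp_IZR; f_equal; ring.
Qed.

Lemma periodic_representative (T t : R) : 0 < T ->
  exists s, 0 <= s <= T /\ forall f, periodic T f -> f t = f s.
Proof.
intros HT; destruct (base_Int_part (t / T)) as [H1 H2].
exists (t + IZR (- Int_part (t / T)) * T); split.
- assert (E : t = t / T * T) by (field; lra).
  rewrite opp_IZR; nra.
- intros f Hf; now rewrite periodic_translate.
Qed.

Lemma continuous_max (f : R -> R) (T : R) : 0 < T -> (forall t, continuous f t) ->
  exists s, 0 <= s <= T /\ forall t, 0 <= t <= T -> f t <= f s.
Proof.
intros HT Hc.
destruct (continuity_ab_maj f 0 T) as [s [Hs1 Hs2]]; [lra| |].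
{ intros c _; apply continuity_pt_filterlim; apply Hc. }
now exists s.
Qed.

Lemma periodic_max (T : R) (f : R -> R) : 0 < T -> periodic T f ->
  (forall t, continuous f t) -> exists s, forall t, f t <= f s.
Proof.
intros HT Hf Hc.
destruct (continuous_max f T HT Hc) as [s [_ Hs]].
exists s; intros t; destruct (periodic_representative T t HT) as [r [Hr E]].
rewrite (E f Hf); auto.
Qed.

Lemma periodic_min (T : R) (f : R -> R) : 0 < T -> periodic T f ->
  (forall t, continuous f t) -> exists s, forall t, f s <= f t.
Proof.
intros HT Hf Hc.
destruct (periodic_max T (fun t => - f t) HT) as [s Hs].
- intros t; now rewrite Hf.
- intros t; now apply (continuous_opp f).
- exists s; intros t; specialize (Hs t); lra.
Qed.

Lemma periodic_bounded (T : R) (f : R -> R) : 0 < T -> periodic T f ->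
  (forall t, continuous f t) -> exists M, 0 < M /\ forall t, Rabs (f t) <= M.
Proof.
intros HT Hf Hc.
destruct (periodic_max T f HT Hf Hc) as [s Hs].
destruct (periodic_min T f HT Hf Hc) as [r Hr].
exists (Rabs (f s) + Rabs (f r) + 1); split.
- assert (H1 := Rabs_pos (f s)); assert (H2 := Rabs_pos (f r)); lra.
- intros t; apply Rabs_le; specialize (Hs t); specialize (Hr t).
  assert (H1 := Rle_abs (f s)); assert (H2 := Rle_abs (- f r)).
  assert (H3 := Rabs_pos (f s)); assert (H4 := Rabs_pos (f r)).
  rewrite Rabs_Ropp in H2; lra.
Qed.

Lemma is_derive_at_max (f : R -> R) (s l : R) :
  is_derive f s l -> (forall t, f t <= f s) -> l = 0.
Proof.
intros H Hm; apply is_derive_Reals in H.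
assert (pr : derivable_pt f s) by now exists l.
rewrite <- (derive_pt_eq_0 f s l pr H).
apply (deriv_maximum f (s - 1) (s + 1) s pr); [lra|lra|auto].
Qed.

Lemma periodic_is_derive (T : R) (f df : R -> R) :
  periodic T f -> (forall t, is_derive f t (df t)) -> periodic T df.
Proof.
intros Hf H t.
rewrite <- (is_derive_unique f t (df t) (H t)).
rewrite <- (is_derive_unique (fun x => f (x + T)) t (df (t + T))).
- apply Derive_ext; intros x; apply Hf.
- apply is_derive_shift, H.
Qed.

(** * Limits of solutions *)

(** Pointwise convergence suffices to pass to the limit in [y' = g + k], because the
    equi-Lipschitz [k n] turn it into a uniform quadratic estimate: by the mean value
    theorem, [y n] minus a primitive of [g] differs from its tangent at [s] by at most
    [C (t - s)^2], and this bound survives the limit. *)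
Lemma is_derive_of_lipschitz_limit (g : R -> R) (y k : nat -> R -> R) (yl kl : R -> R)
    (C : R) :
  (forall t, continuous g t) ->
  (forall n t, is_derive (y n) t (g t + k n t)) ->
  (forall n s t, Rabs (k n t - k n s) <= C * Rabs (t - s)) ->
  (forall t, is_lim_seq (fun n => y n t) (yl t)) ->
  (forall t, is_lim_seq (fun n => k n t) (kl t)) ->
  forall t, is_derive yl t (g t + kl t).
Proof.
intros Hg Hy Hk Hyl Hkl s.
assert (HC : 0 <= C).
{ specialize (Hk 0%nat 0 1). rewrite (Rabs_pos_eq (1 - 0)) in Hk by lra.
  assert (H := Rabs_pos (k 0%nat 1 - k 0%nat 0)); lra. }
pose (G := fun t => RInt g 0 t).
assert (HG : forall t, is_derive G t (g t)) by (intros; now apply is_derive_primitive).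
assert (Hn : forall n t,
  Rabs ((y n t - G t) - (y n s - G s) - (t - s) * k n s) <= C * (t - s) ^ 2).
{ intros n t.
  destruct (mean_value (fun t => y n t - G t) (fun t => k n t) s t) as [c [Hc ->]].
  { intros u _. apply is_derive_eq with (minus (g u + k n u) (g u)).
    - apply (is_derive_minus (y n) G); auto.
    - change (g u + k n u - g u = k n u); ring. }
  replace (k n c * (t - s) - (t - s) * k n s) with ((t - s) * (k n c - k n s)) by ring.
  rewrite Rabs_mult.
  apply Rle_trans with (Rabs (t - s) * (C * Rabs (t - s))).
  - apply Rmult_le_compat_l; [apply Rabs_pos|].
    apply Rle_trans with (1 := Hk n s c).
    apply Rmult_le_compat_l; [exact HC|].
    revert Hc; unfold Rmin, Rmax, Rabs.
    destruct (Rle_dec s t); intros Hc; destruct (Rcase_abs (c - s)), (Rcase_abs (t - s)); lra.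
  - rewrite <- Rsqr_pow2, (Rsqr_abs (t - s)); unfold Rsqr; lra. }
assert (Hl : forall t,
  Rabs ((yl t - G t) - (yl s - G s) - (t - s) * kl s) <= C * (t - s) ^ 2).
{ intros t.
  apply (is_lim_seq_le
    (fun n => Rabs ((y n t - G t) - (y n s - G s) - (t - s) * k n s))
    (fun _ => C * (t - s) ^ 2)
    (Rabs ((yl t - G t) - (yl s - G s) - (t - s) * kl s)) (C * (t - s) ^ 2)).
  - intros n; apply Hn.
  - apply (is_lim_seq_abs _ (Finite _)).
    apply is_lim_seq_minus'; [apply is_lim_seq_minus'; apply is_lim_seq_minus'; auto|].
    + apply is_lim_seq_const.
    + apply is_lim_seq_const.
    + apply is_lim_seq_mult'; [apply is_lim_seq_const|auto].
  - apply is_lim_seq_const. }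
assert (Hz : is_derive (fun t => yl t - G t) s (kl s)).
{ apply is_derive_Reals; intros eps Heps.
  assert (Hd : 0 < eps / (C + 1)) by (apply Rdiv_lt_0_compat; lra).
  exists (mkposreal _ Hd); intros h Hh0 Hh; simpl in Hh.
  replace ((yl (s + h) - G (s + h) - (yl s - G s)) / h - kl s)
    with (((yl (s + h) - G (s + h)) - (yl s - G s) - (s + h - s) * kl s) / h)
    by (field; auto).
  unfold Rdiv at 1; rewrite Rabs_mult, Rabs_inv.
  specialize (Hl (s + h)).
  replace (s + h - s) with h in * by ring.
  assert (Hp := Rabs_pos_lt h Hh0).
  replace (h ^ 2) with (Rabs h * Rabs h) in Hl
    by (rewrite <- Rabs_mult, Rabs_pos_eq; [ring|nra]).
  apply Rle_lt_trans with (C * Rabs h).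
  - apply (Rmult_le_reg_r (Rabs h)); [exact Hp|].
    rewrite Rmult_assoc, Rinv_l, Rmult_1_r by lra; lra.
  - apply Rle_lt_trans with ((C + 1) * Rabs h); [nra|].
    apply (Rmult_lt_compat_l (C + 1)) in Hh; [|lra].
    replace ((C + 1) * (eps / (C + 1))) with eps in Hh by (field; lra); exact Hh. }
apply (is_derive_ext (fun t => plus (G t) (yl t - G t))).
- intros t; change (G t + (yl t - G t) = yl t); ring.
- apply (is_derive_plus G); auto.
Qed.

(** * Linear periodic equations *)

Lemma homogeneous_solution (b B d : R -> R) :
  (forall t, is_derive B t (b t)) -> (forall t, is_derive d t (b t * d t)) ->
  forall t, d t = d 0 * exp (B t - B 0).
Proof.
intros HB Hd t.
assert (H : d t * exp (- B t) = d 0 * exp (- B 0)).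
{ apply (is_derive_zero_const (fun t => d t * exp (- B t))); intros s.
  auto_derive; [repeat split; eexists; eauto|].
  derive_known (HB s).
  derive_known (Hd s); ring. }
replace (B t - B 0) with (- B 0 + B t) by ring.
rewrite exp_plus, <- Rmult_assoc, <- H, Rmult_assoc, <- exp_plus.
rewrite Rplus_opp_l, exp_0; ring.
Qed.

(** Variation of constants for [z' = b z + h], with the initial value chosen such that
    [z T = z 0]; this determines it uniquely when [exp (int_0^T b)] is not [1]. *)
Definition periodic_resolvent (T : R) (b h : R -> R) (t : R) : R :=
  let B := RInt b 0 in
  let J := fun x => RInt (fun s => exp (- B s) * h s) 0 x in
  exp (B t) * (exp (B T) / (1 - exp (B T)) * J T + J t).

Lemma is_derive_periodic_resolvent (T : R) (b h : R -> R) :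
  (forall t, continuous b t) -> (forall t, continuous h t) ->
  forall t, is_derive (periodic_resolvent T b h) t
              (b t * periodic_resolvent T b h t + h t).
Proof.
intros Hb Hh t; unfold periodic_resolvent; cbv zeta.
set (B := fun x => RInt b 0 x).
change (RInt b 0) with B.
assert (HB : forall s, is_derive B s (b s)) by (intros; now apply is_derive_primitive).
set (j := fun s => exp (- B s) * h s).
assert (Hj : forall s, continuous j s).
{ intros s; apply (continuous_mult (fun s => exp (- B s)) h); [|apply Hh].
  apply (ex_derive_continuous (fun s => exp (- B s))).
  auto_derive; exact (ex_intro _ _ (HB s)). }
set (J := fun x => RInt j 0 x).
assert (HJ : forall s, is_derive J s (j s)) by (intros; now apply is_derive_primitive).
set (A := exp (B T) / (1 - exp (B T)) * RInt j 0 T).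
change (is_derive (fun t => exp (B t) * (A + J t)) t
  (b t * (exp (B t) * (A + J t)) + h t)).
auto_derive; [repeat split; eexists; eauto|].
derive_known (HB t).
derive_known (HJ t).
assert (E : exp (B t) * exp (- B t) = 1) by (rewrite <- exp_plus, Rplus_opp_r; apply exp_0).
unfold j.
replace (exp (B t) * (1 * (exp (- B t) * h t))) with (exp (B t) * exp (- B t) * h t) by ring.
rewrite E; ring.
Qed.

Lemma periodic_periodic_resolvent (T : R) (b h : R -> R) :
  (forall t, continuous b t) -> (forall t, continuous h t) ->
  periodic T b -> periodic T h -> RInt b 0 T <> 0 ->
  periodic T (periodic_resolvent T b h).
Proof.
intros Hb Hh Tb Th H0.
set (z := periodic_resolvent T b h).
assert (Hz := is_derive_periodic_resolvent T b h Hb Hh); fold z in Hz.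
assert (E0 : z (0 + T) = z 0).
{ unfold z, periodic_resolvent; rewrite Rplus_0_l, !RInt_point_R, exp_0.
  assert (1 - exp (RInt b 0 T) <> 0).
  { intros H; apply H0, exp_inv; rewrite exp_0; lra. }
  field; auto. }
assert (Hd : forall t, is_derive (fun t => z (t + T) - z t) t (b t * (z (t + T) - z t))).
{ intros t; apply is_derive_eq with (minus (b (t+T) * z (t+T) + h (t+T)) (b t * z t + h t)).
  - apply (is_derive_minus (fun t => z (t + T)) z); [apply is_derive_shift|]; apply Hz.
  - rewrite Tb, Th.
    change (b t * z (t+T) + h t - (b t * z t + h t) = b t * (z (t + T) - z t)); ring. }
intros t.
assert (E := homogeneous_solution b _ _ (fun t => is_derive_primitive b t Hb) Hd t).
cbv beta in E.
rewrite E0 in E; nra.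
Qed.

(** [z exp (c t)] is nondecreasing, so [z t <= z (t + T) exp (c T)], where
    [z (t + T) = z t] and [exp (c T) > 1]. *)
Lemma periodic_comparison (T c : R) (z dz : R -> R) :
  0 < T -> 0 < c -> periodic T z -> (forall t, is_derive z t (dz t)) ->
  (forall t, 0 <= dz t + c * z t) -> forall t, 0 <= z t.
Proof.
intros HT Hc Tz Hz Hd t.
assert (H : z t * exp (c * t) <= z (t + T) * exp (c * (t + T))).
{ apply (is_derive_nonneg_incr (fun t => z t * exp (c * t))
    (fun t => (dz t + c * z t) * exp (c * t))); [| |lra].
  - intros s _; auto_derive; [exact (ex_intro _ _ (Hz s))|].
    derive_known (Hz s); ring.
  - intros s _; apply Rmult_le_pos; [apply Hd|left; apply exp_pos]. }
rewrite Tz, Rmult_plus_distr_l, exp_plus in H.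
assert (H1 := exp_pos (c * t)).
assert (H2 : 1 < exp (c * T)) by (rewrite <- exp_0; apply exp_increasing, Rmult_lt_0_compat; lra).
assert (H0 : 0 < exp (c * t) * (exp (c * T) - 1)) by (apply Rmult_lt_0_compat; lra).
destruct (Rle_lt_dec 0 (z t)) as [H3|H3]; [exact H3|nra].
Qed.

(** * Periodic upper solutions of [y' = y^2 + g] *)

(** The derivative is quantified rather than written [Derive p t], so that solutions,
    shifts and perturbations qualify directly by their differentiability proofs. *)
Definition upper_solution (T : R) (g p : R -> R) : Prop :=
  periodic T p /\ forall t, exists l, is_derive p t l /\ p t ^ 2 + g t <= l.

Definition riccati_periodic (T : R) (g p : R -> R) : Prop :=
  periodic T p /\ forall t, is_derive p t (p t ^ 2 + g t).

Lemma riccati_periodic_upper (T : R) (g h p : R -> R) :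
  riccati_periodic T g p -> (forall t, h t <= g t) -> upper_solution T h p.
Proof.
intros [Tp Hp] Hh; split; [exact Tp|].
intros t; exists (p t ^ 2 + g t); split; [apply Hp|]; specialize (Hh t); lra.
Qed.

Lemma upper_solution_continuous (T : R) (g p : R -> R) (t : R) :
  upper_solution T g p -> continuous p t.
Proof.
intros [_ Hp]; destruct (Hp t) as [l [Hl _]]; exact (is_derive_continuous _ _ _ Hl).
Qed.

(** At a maximum or a minimum of [p] the derivative vanishes, so the inequality there
    reads [p^2 <= - g < K^2]. *)
Lemma upper_solution_bound (T : R) (g p : R -> R) (K : R) :
  0 < T -> 0 < K -> (forall t, 0 < K ^ 2 + g t) -> upper_solution T g p ->
  forall t, - K <= p t <= K.
Proof.
intros HT HK Hg Hp t.
assert (Hc := fun t => upper_solution_continuous T g p t Hp).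
destruct Hp as [Tp Hp].
destruct (periodic_max T p HT Tp Hc) as [s Hs].
destruct (periodic_min T p HT Tp Hc) as [r Hr].
assert (Bs : p s ^ 2 <= - g s).
{ destruct (Hp s) as [l [Hl Hl']]; rewrite (is_derive_at_max p s l Hl Hs) in Hl'; lra. }
assert (Br : p r ^ 2 <= - g r).
{ destruct (Hp r) as [l [Hl Hl']].
  assert (E : opp l = 0).
  { apply (is_derive_at_max (fun t => - p t) r); [now apply (is_derive_opp p)|].
    intros u; specialize (Hr u); lra. }
  change (- l = 0) in E; lra. }
assert (Gs := Hg s); assert (Gr := Hg r).
specialize (Hs t); specialize (Hr t); split; nra.
Qed.

(** The equation is rewritten as [y' + 2 K y = (y^2 + 2 K y) + g]: the right-hand side
    is increasing in [y] for [y >= - K], and the left-hand side has an order-preserving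
    inverse by [periodic_comparison]. Solving for the left-hand side is then a monotone
    iteration. It starts at the constant [- K], which lies below every upper solution. *)
Fixpoint lower_iterate (T K : R) (g : R -> R) (n : nat) : R -> R :=
  match n with
  | O => fun _ => - K
  | S n => periodic_resolvent T (fun _ => - (2 * K))
             (fun t => lower_iterate T K g n t ^ 2
                       + 2 * K * lower_iterate T K g n t + g t)
  end.

Section Iteration.

Context (T K : R) (g : R -> R).
Context (HT : 0 < T) (HK : 0 < K) (Tg : periodic T g) (Cg : forall t, continuous g t)
        (HKg : forall t, 0 < K ^ 2 + g t).

Notation y := (lower_iterate T K g).

Lemma lower_iterate_source_continuous n t :
  continuous (y n) t -> continuous (fun t => y n t ^ 2 + 2 * K * y n t + g t) t.
Proof.
intros H.
apply (continuous_plus (fun t => y n t ^ 2 + 2 * K * y n t) g); [|apply Cg].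
apply (continuous_ext (fun t => mult (y n t) (plus (y n t) (2 * K)))).
{ intros x; change (y n x * (y n x + 2 * K) = y n x ^ 2 + 2 * K * y n x); ring. }
apply (continuous_mult (y n)); [exact H|].
apply (continuous_plus (y n)); [exact H|apply continuous_const].
Qed.

Lemma is_derive_lower_iterate n :
  (forall t, continuous (y n) t) ->
  forall t, is_derive (y (S n)) t
    (g t + (- (2 * K) * y (S n) t + (y n t ^ 2 + 2 * K * y n t))).
Proof.
intros H t; simpl lower_iterate at 1.
eapply is_derive_eq; [apply is_derive_periodic_resolvent|].
- intros; apply continuous_const.
- intros; now apply lower_iterate_source_continuous.
- simpl; ring.
Qed.

Lemma lower_iterate_continuous n t : continuous (y n) t.
Proof.
revert t; induction n as [|n IH]; intros t; [apply continuous_const|].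
eapply is_derive_continuous, is_derive_lower_iterate, IH.
Qed.

Lemma lower_iterate_periodic n : periodic T (y n).
Proof.
induction n as [|n IH]; [easy|].
apply periodic_periodic_resolvent.
- intros; apply continuous_const.
- intros; apply lower_iterate_source_continuous, lower_iterate_continuous.
- easy.
- intros t; now rewrite IH, Tg.
- rewrite (RInt_const 0 T).
  change ((T - 0) * - (2 * K) <> 0); nra.
Qed.

Let Dy n t := is_derive_lower_iterate n (lower_iterate_continuous n) t.

Lemma lower_iterate_incr n : forall t, - K <= y n t <= y (S n) t.
Proof.
induction n as [|n IH].
- intros t; split; [simpl; lra|].
  enough (0 <= y 1 t - - K) by (simpl in *; lra).
  revert t; eapply (periodic_comparison T (2 * K) _
    (fun t => g t + (- (2 * K) * y 1 t + (y 0 t ^ 2 + 2 * K * y 0 t)) - 0)); [lra|lra| | |].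
  + intros t; now rewrite lower_iterate_periodic.
  + intros t; apply (is_derive_minus (y 1) (fun _ => - K)); [apply Dy|apply (is_derive_const (-K))].
  + intros t; specialize (HKg t); simpl (y 0 t); nra.
- intros t; split; [specialize (IH t); lra|].
  enough (0 <= y (S (S n)) t - y (S n) t) by lra.
  revert t; eapply (periodic_comparison T (2 * K)
     (fun t => y (S (S n)) t - y (S n) t)
    (fun t => g t + (- (2 * K) * y (S (S n)) t + (y (S n) t ^ 2 + 2 * K * y (S n) t))
       - (g t + (- (2 * K) * y (S n) t + (y n t ^ 2 + 2 * K * y n t))))); [lra|lra| | |].
  + intros t; now rewrite !lower_iterate_periodic.
  + intros t; apply (is_derive_minus (y (S (S n))) (y (S n))); apply Dy.
  + intros t; specialize (IH t).
    set (u := y (S (S n)) t); set (v := y (S n) t) in *; set (w := y n t) in *; nra.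
Qed.

Lemma lower_iterate_le_upper n p : upper_solution T g p -> forall t, y n t <= p t.
Proof.
intros Hp.
assert (B := upper_solution_bound T g p K HT HK HKg Hp).
assert (HD : exists dp, forall t, is_derive p t (dp t) /\ p t ^ 2 + g t <= dp t).
{ exists (Derive p); intros t; destruct Hp as [_ Hp]; destruct (Hp t) as [l [Hl Hl']].
  now rewrite (is_derive_unique p t l Hl). }
destruct HD as [dp Hdp].
induction n as [|n IH]; intros t; [specialize (B t); simpl; lra|].
enough (0 <= p t - y (S n) t) by lra.
revert t; apply (periodic_comparison T (2 * K) (fun t => p t - y (S n) t)
  (fun t => dp t - (g t + (- (2 * K) * y (S n) t + (y n t ^ 2 + 2 * K * y n t)))));
  [lra|lra| | |].
- intros t; destruct Hp as [Tp _]; now rewrite Tp, lower_iterate_periodic.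
- intros t; apply (is_derive_minus p (y (S n))); [apply Hdp|apply Dy].
- intros t; destruct (Hdp t) as [_ H]; specialize (B t); specialize (IH t).
  assert (I := lower_iterate_incr n t).
  set (u := y (S n) t) in *; set (w := y n t) in *; nra.
Qed.

(** The iterates increase and stay below every upper solution; their limit solves the
    equation by [is_derive_of_lipschitz_limit], since iterates with values in [[-K, K]]
    are equi-Lipschitz. *)
Lemma minimal_solution (q : R -> R) :
  upper_solution T g q ->
  exists phi, riccati_periodic T g phi /\
    forall p, upper_solution T g p -> forall t, phi t <= p t.
Proof.
intros Hq.
pose (phi := fun t => real (Lim_seq (fun n => y n t))).
assert (Hlim : forall t, is_lim_seq (fun n => y n t) (phi t)).
{ intros t; apply Lim_seq_correct', (ex_finite_lim_seq_incr _ (q t)).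
  - intros n; apply lower_iterate_incr.
  - intros n; now apply lower_iterate_le_upper. }
assert (B : forall n t, - K <= y n t <= K).
{ intros n t; assert (I := lower_iterate_incr n t).
  assert (J := lower_iterate_le_upper n q Hq t).
  assert (L := upper_solution_bound T g q K HT HK HKg Hq t); lra. }
destruct (periodic_bounded T g HT Tg Cg) as [G [HG Bg]].
(* A bound on the right-hand sides of the iteration: [2 K |y (S n)|], [|y n|^2] and
   [2 K |y n|] contribute [2 K^2], [K^2] and [2 K^2]. *)
pose (L := G + 5 * K ^ 2).
assert (HL : forall n s t, Rabs (y n t - y n s) <= L * Rabs (t - s)).
{ intros [|n] s t.
  - simpl; rewrite Rminus_diag, Rabs_R0; apply Rmult_le_pos; [unfold L; nra|apply Rabs_pos].
  - edestruct (mean_value (y (S n))) as [c [_ ->]]; [intros; apply Dy|].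
    rewrite Rabs_mult; apply Rmult_le_compat_r; [apply Rabs_pos|].
    assert (B1 := B n c); assert (B2 := B (S n) c).
    specialize (Bg c); apply Rabs_le_between in Bg.
    set (u := y (S n) c) in *; set (w := y n c) in *.
    unfold L; apply Rabs_le; nra. }
exists phi; split; [split|].
- intros t; unfold phi; f_equal; apply Lim_seq_ext; intros n; apply lower_iterate_periodic.
- intros t.
  apply is_derive_eq with (g t + (- (2 * K) * phi t + (phi t ^ 2 + 2 * K * phi t))); [|ring].
  apply (is_derive_of_lipschitz_limit g (fun n => y (S n))
    (fun n t => - (2 * K) * y (S n) t + (y n t ^ 2 + 2 * K * y n t)) phi
    (fun t => - (2 * K) * phi t + (phi t ^ 2 + 2 * K * phi t)) (6 * K * L)).
  + exact Cg.
  + intros n s; apply Dy.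
  + intros n s u.
    replace (_ - _) with (- (2 * K) * (y (S n) u - y (S n) s)
      + (y n u + y n s + 2 * K) * (y n u - y n s)) by ring.
    eapply Rle_trans; [apply Rabs_triang|]; rewrite !Rabs_mult.
    assert (H1 := HL n s u); assert (H2 := HL (S n) s u).
    assert (B1 := B n s); assert (B2 := B n u).
    assert (H3 : Rabs (- (2 * K)) <= 2 * K) by (apply Rabs_le; lra).
    assert (H4 : Rabs (y n u + y n s + 2 * K) <= 4 * K) by (apply Rabs_le; lra).
    assert (P1 := Rabs_pos (y n u - y n s)).
    assert (P2 := Rabs_pos (y (S n) u - y (S n) s)).
    apply Rle_trans with (2 * K * (L * Rabs (u - s)) + 4 * K * (L * Rabs (u - s))); [|lra].
    apply Rplus_le_compat; apply Rmult_le_compat; auto using Rabs_pos.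
  + intros s; now apply (is_lim_seq_incr_1 (fun n => y n s)).
  + intros s.
    apply is_lim_seq_plus'; [|apply is_lim_seq_plus'].
    * apply is_lim_seq_mult'; [apply is_lim_seq_const|].
      now apply (is_lim_seq_incr_1 (fun n => y n s)).
    * simpl; repeat apply is_lim_seq_mult'; auto; apply is_lim_seq_const.
    * apply is_lim_seq_mult'; [apply is_lim_seq_const|auto].
- intros p Hp t.
  apply (is_lim_seq_le (fun n => y n t) (fun _ => p t) (phi t) (p t)).
  + intros n; now apply lower_iterate_le_upper.
  + apply Hlim.
  + apply is_lim_seq_const.
Qed.

End Iteration.

Lemma upper_solution_le (T : R) (g h p : R -> R) :
  (forall t, h t <= g t) -> upper_solution T g p -> upper_solution T h p.
Proof.
intros Hh [Tp Hp]; split; [exact Tp|].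
intros t; destruct (Hp t) as [l [Hl Hl']]; exists l; split; [exact Hl|].
specialize (Hh t); lra.
Qed.

(** If [phi] has nonzero mean, [z' = 2 phi z + 1] has a periodic solution [z]. For
    [p = phi + e z] one computes [p' = p^2 + g + e - e^2 z^2], so [p] gains at least
    [e / 2] once [e z^2 <= 1 / 2]. *)
Lemma riccati_periodic_perturb (T : R) (g phi : R -> R) :
  0 < T -> riccati_periodic T g phi -> RInt phi 0 T <> 0 ->
  exists eps p, 0 < eps /\ upper_solution T (fun t => g t + eps) p.
Proof.
intros HT [Tphi Hphi] H0.
assert (Cphi : forall t, continuous phi t) by (intros t; eapply is_derive_continuous, Hphi).
set (b := fun t => 2 * phi t).
assert (Cb : forall t, continuous b t).
{ intros t; apply (continuous_mult (fun _ => 2) phi); [apply continuous_const|apply Cphi]. }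
assert (C1 : forall t : R, continuous (fun _ : R => 1) t) by (intros; apply continuous_const).
pose (z := periodic_resolvent T b (fun _ => 1)).
assert (Hz := is_derive_periodic_resolvent T b (fun _ => 1) Cb C1); fold z in Hz.
assert (Tz : periodic T z).
{ apply periodic_periodic_resolvent; auto.
  - intros t; unfold b; now rewrite Tphi.
  - easy.
  - assert (E : RInt b 0 T = 2 * RInt phi 0 T).
    { apply (RInt_scal phi 0 T 2).
      now apply (@ex_RInt_continuous R_CompleteNormedModule). }
    rewrite E; lra. }
destruct (periodic_bounded T z HT Tz) as [Z [HZ Bz]].
{ intros t; eapply is_derive_continuous, Hz. }
assert (H : 0 < / (2 * (Z ^ 2 + 1))) by (apply Rinv_0_lt_compat; nra).
set (e := / (2 * (Z ^ 2 + 1))) in *.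
assert (He : e * (Z ^ 2) <= 1 / 2).
{ apply Rmult_le_reg_r with (2 * (Z ^ 2 + 1)); [nra|].
  replace (e * Z ^ 2 * (2 * (Z ^ 2 + 1))) with (Z ^ 2); [nra|unfold e; field; nra]. }
exists (e / 2), (fun t => phi t + e * z t); split; [lra|split].
- intros t; now rewrite Tphi, Tz.
- intros t; exists (phi t ^ 2 + g t + e * (b t * z t + 1)); split.
  + apply (is_derive_plus phi (fun t => e * z t)); [apply Hphi|].
    apply (is_derive_scal z t e), Hz.
  + assert (Hb : z t ^ 2 <= Z ^ 2).
    { specialize (Bz t); apply Rabs_le_between in Bz; nra. }
    assert (e * z t ^ 2 <= 1 / 2) by nra.
    assert (e * (e * z t ^ 2) <= e * (1 / 2)) by nra.
    unfold b; nra.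
Qed.

(** The pair consists of the largest parameter that admits an upper solution and the
    limit of the least solutions for parameters increasing to it. A nonzero mean would
    contradict maximality by [riccati_periodic_perturb]. In terms of the Hill operator
    [- u'' - g u], with [phi = - u' / u], this is the principal periodic eigenvalue and
    its positive periodic eigenfunction. *)
Lemma principal_solution (T : R) (g : R -> R) :
  0 < T -> periodic T g -> (forall t, continuous g t) ->
  exists lam phi, riccati_periodic T (fun t => g t + lam) phi /\ RInt phi 0 T = 0.
Proof.
intros HT Tg Cg.
destruct (periodic_bounded T g HT Tg Cg) as [G [HG Bg]].
assert (Bg' : forall t, - G <= g t <= G) by (intros t; apply Rabs_le_between, Bg).
pose (admissible := fun lam => exists p, upper_solution T (fun t => g t + lam) p).
assert (adm_le : forall lam, admissible lam -> lam <= G).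
{ intros lam [p Hp].
  assert (Cp := fun t => upper_solution_continuous T _ p t Hp).
  destruct Hp as [Tp Hp].
  destruct (periodic_max T p HT Tp Cp) as [s Hs].
  destruct (Hp s) as [l [Hl Hl']]; rewrite (is_derive_at_max p s l Hl Hs) in Hl'.
  specialize (Bg' s); nra. }
assert (adm_down : forall lam lam', admissible lam -> lam' <= lam -> admissible lam').
{ intros lam lam' [p Hp] Hl; exists p; revert Hp; apply upper_solution_le.
  intros t; lra. }
destruct (completeness admissible) as [L [HL1 HL2]].
{ now exists G. }
{ exists (- G), (fun _ => 0); split; [easy|].
  intros t; exists 0; split; [apply (is_derive_const 0)|].
  specialize (Bg' t); lra. }
pose (lam := fun n => L - / (INR n + 1)).
assert (Hlam : forall n, 0 < / (INR n + 1) <= 1).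
{ intros n; assert (H := pos_INR n); split; [apply Rinv_0_lt_compat; lra|].
  rewrite <- Rinv_1; apply Rinv_le_contravar; lra. }
assert (Hadm : forall n, admissible (lam n)).
{ intros n; apply NNPP; intros H.
  specialize (Hlam n).
  assert (L <= lam n); [|unfold lam in *; lra].
  apply HL2; intros x Hx; apply Rnot_lt_le; intros Hlt; apply H.
  apply adm_down with x; [exact Hx|lra]. }
(* One [K] for all the parameters [lam n >= L - 1], as [K <= K^2]. *)
pose (K := G + Rabs L + 2).
assert (HK2 : 2 <= K) by (assert (H := Rabs_pos L); unfold K; lra).
assert (BL := Rle_abs L); assert (BL' := Rle_abs (- L)); rewrite Rabs_Ropp in BL'.
assert (HK : forall n t, 0 < K ^ 2 + (g t + lam n)).
{ intros n t; specialize (Bg' t); specialize (Hlam n); unfold lam.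
  assert (K <= K ^ 2) by nra.
  assert (K = G + Rabs L + 2) by reflexivity; lra. }
assert (Hmin : forall n, exists phi, riccati_periodic T (fun t => g t + lam n) phi /\
    forall p, upper_solution T (fun t => g t + lam n) p -> forall t, phi t <= p t).
{ intros n; destruct (Hadm n) as [q Hq].
  apply (minimal_solution T K _ HT) with (q := q); auto; [lra| |].
  - intros t; now rewrite Tg.
  - intros t; apply (continuous_plus g); [apply Cg|apply continuous_const]. }
pose (phi := fun n => proj1_sig (constructive_indefinite_description _ (Hmin n))).
assert (Hphi : forall n, riccati_periodic T (fun t => g t + lam n) (phi n) /\
    forall p, upper_solution T (fun t => g t + lam n) p -> forall t, phi n t <= p t).
{ intros n; exact (proj2_sig (constructive_indefinite_description _ (Hmin n))). }
clearbody phi.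
assert (lam_incr : forall n, lam n <= lam (S n)).
{ intros n; unfold lam; rewrite S_INR.
  assert (H := pos_INR n).
  assert (/ (INR n + 1 + 1) <= / (INR n + 1)) by (apply Rinv_le_contravar; lra); lra. }
assert (phi_incr : forall n t, phi n t <= phi (S n) t).
{ intros n; apply Hphi.
  apply (riccati_periodic_upper _ _ _ _ (proj1 (Hphi (S n)))).
  intros t; specialize (lam_incr n); lra. }
assert (B : forall n t, - K <= phi n t <= K).
{ intros n; apply (upper_solution_bound T (fun t => g t + lam n)); [lra|lra|apply HK|].
  apply (riccati_periodic_upper _ _ _ _ (proj1 (Hphi n))); intros t; lra. }
pose (y := fun t => real (Lim_seq (fun n => phi n t))).
assert (Hlim : forall t, is_lim_seq (fun n => phi n t) (y t)).
{ intros t; apply Lim_seq_correct', (ex_finite_lim_seq_incr _ K); intros n.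
  - apply phi_incr.
  - apply B. }
assert (lam_lim : is_lim_seq lam L).
{ unfold lam; replace (Finite L) with (Finite (L - 0)) by (f_equal; ring).
  apply is_lim_seq_minus'; [apply is_lim_seq_const|].
  apply (is_lim_seq_inv (fun n => INR n + 1) p_infty); [|easy].
  apply (is_lim_seq_ext (fun n => INR (S n))); [intros; apply S_INR|].
  apply (is_lim_seq_incr_1 INR), is_lim_seq_INR. }
(* [K^2 + K] bounds [|phi^2 + g + lam n|], as [|g + lam n| <= G + |L| + 1 <= K]. *)
pose (D := K ^ 2 + K).
assert (HD : forall n s t, Rabs (phi n t - phi n s) <= D * Rabs (t - s)).
{ intros n s t.
  edestruct (mean_value (phi n)) as [c [_ ->]]; [intros; apply (Hphi n)|].
  rewrite Rabs_mult; apply Rmult_le_compat_r; [apply Rabs_pos|].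
  assert (B1 := B n c); specialize (Bg' c); specialize (Hlam n).
  unfold lam, D; apply Rabs_le.
  assert (K = G + Rabs L + 2) by reflexivity.
  set (u := phi n c) in *; nra. }
assert (Hy : riccati_periodic T (fun t => g t + L) y).
{ split.
  - intros t; unfold y; f_equal; apply Lim_seq_ext; intros n; apply (Hphi n).
  - intros t.
    apply is_derive_eq with (g t + (y t ^ 2 + L)); [|ring].
    apply (is_derive_of_lipschitz_limit g phi (fun n t => phi n t ^ 2 + lam n) y
      (fun t => y t ^ 2 + L) (2 * K * D)).
    + exact Cg.
    + intros n s; eapply is_derive_eq; [apply (Hphi n)|cbv beta; ring].
    + intros n s u.
      replace (_ - _) with ((phi n u + phi n s) * (phi n u - phi n s)) by ring.
      rewrite Rabs_mult, Rmult_assoc.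
      apply Rmult_le_compat; auto using Rabs_pos.
      assert (B1 := B n s); assert (B2 := B n u); apply Rabs_le; lra.
    + exact Hlim.
    + intros s; apply is_lim_seq_plus'; [|exact lam_lim].
      simpl; repeat apply is_lim_seq_mult'; auto; apply is_lim_seq_const. }
exists L, y; split; [exact Hy|].
apply NNPP; intros H.
destruct (riccati_periodic_perturb T _ y HT Hy H) as [e [p [He Hp]]].
assert (L + e <= L); [|lra].
apply HL1; exists p; revert Hp; apply upper_solution_le; intros t; lra.
Qed.

(** * The discriminant of the normal form *)

Lemma C1_per_upper (T : R) (g p : R -> R) :
  C1_per T p -> (forall t, p t ^ 2 + g t <= Derive p t) -> upper_solution T g p.
Proof.
intros [Tp [Hp _]] H; split; [exact Tp|].
intros t; exists (Derive p t); split; [apply Derive_correct, Hp|apply H].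
Qed.

Lemma riccati_periodic_C1 (T : R) (g p : R -> R) :
  (forall t, continuous g t) -> riccati_periodic T g p -> C1_per T p.
Proof.
intros Cg [Tp Hp]; repeat split; [exact Tp|now intros t; eexists; apply Hp|].
intros t; apply (continuous_ext (fun t => plus (mult (p t) (p t)) (g t))).
- intros s; rewrite (is_derive_unique _ _ _ (Hp s)).
  change (p s * p s + g s = p s ^ 2 + g s); ring.
- assert (C : continuous p t) by (eapply is_derive_continuous, Hp).
  apply (continuous_plus (fun t => mult (p t) (p t)) g); [|apply Cg].
  now apply (continuous_mult p p).
Qed.

Section Weight.

Context (T : R) (q : R -> R) (Cq : forall t, continuous q t).

Definition weight (t : R) : R := exp (- 2 * RInt q 0 t).

Lemma is_derive_weight_mult (p : R -> R) (t l : R) :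
  is_derive p t l ->
  is_derive (fun t => weight t * p t) t (weight t * (l - 2 * q t * p t)).
Proof.
intros Hp; unfold weight.
pose (Q := fun t => RInt q 0 t).
assert (HQ : is_derive Q t (q t)) by now apply is_derive_primitive.
change (is_derive (fun t => exp (- 2 * Q t) * p t) t
  (exp (- 2 * Q t) * (l - 2 * q t * p t))).
clearbody Q.
auto_derive; [repeat split; eexists; eauto|].
derive_known HQ; derive_known Hp; ring.
Qed.

Lemma weight_pos (t : R) : 0 < weight t.
Proof. apply exp_pos. Qed.

Lemma weight_continuous (t : R) : continuous weight t.
Proof.
apply (continuous_ext (fun t => weight t * 1)); [intros; apply Rmult_1_r|].
eapply is_derive_continuous, (is_derive_weight_mult (fun _ => 1)), is_derive_const.
Qed.

Lemma weight_0 : weight 0 = 1.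
Proof. unfold weight; rewrite RInt_point_R, Rmult_0_r; apply exp_0. Qed.

Lemma weight_T : RInt q 0 T = 0 -> weight T = 1.
Proof. intros H; unfold weight; rewrite H, Rmult_0_r; apply exp_0. Qed.

End Weight.

(** If [lam < mu], then [weight q * (p - q)] would be strictly increasing, since its
    derivative is at least [weight q * ((p - q)^2 + mu - lam)]; but it is periodic
    because [q] has mean zero. *)
Lemma upper_solution_parameter_le (T : R) (g p q : R -> R) (mu lam : R) :
  0 < T -> upper_solution T (fun t => g t + mu) p ->
  riccati_periodic T (fun t => g t + lam) q -> RInt q 0 T = 0 -> mu <= lam.
Proof.
intros HT [Tp Hp] [Tq Hq] H0; apply Rnot_lt_le; intros Hlt.
assert (Cq : forall t, continuous q t) by (intros t; eapply is_derive_continuous, Hq).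
assert (HD : forall t, is_derive p t (Derive p t) /\ p t ^ 2 + (g t + mu) <= Derive p t).
{ intros t; destruct (Hp t) as [l [Hl Hl']].
  now rewrite (is_derive_unique p t l Hl). }
destruct (mean_value (fun t => weight q t * (p t - q t))
  (fun t => weight q t * ((Derive p t - (q t ^ 2 + (g t + lam))) - 2 * q t * (p t - q t))) 0 T)
  as [c [_ E]].
{ intros t _; apply (is_derive_weight_mult q Cq (fun t => p t - q t)).
  apply (is_derive_minus p q); [apply HD|apply Hq]. }
rewrite weight_0, (weight_T T q H0) in E.
rewrite <- (Rplus_0_l T) in E at 1 2; rewrite Tp, Tq in E.
destruct (HD c) as [_ Hc]; assert (Hw := weight_pos q c).
assert (0 < Derive p c - (q c ^ 2 + (g c + lam)) - 2 * q c * (p c - q c)).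
{ assert (0 <= (p c - q c) ^ 2) by apply pow2_ge_0; nra. }
assert (0 < weight q c * (Derive p c - (q c ^ 2 + (g c + lam)) - 2 * q c * (p c - q c)))
  by now apply Rmult_lt_0_compat.
nra.
Qed.

Lemma centered_continuous (T : R) (g : R -> R) :
  (forall t, continuous g t) -> forall t, continuous (centered T g) t.
Proof.
intros Cg t; apply (continuous_minus g); [apply Cg|apply continuous_const].
Qed.

Lemma centered_periodic (T : R) (g : R -> R) : periodic T g -> periodic T (centered T g).
Proof. intros Tg t; unfold centered; now rewrite Tg. Qed.

(** With [w = weight q], the identity
    [w (q^2 - g) + (w phi)' = w (q - phi)^2 + lam w] is integrated over a period, where
    the integral of [(w phi)'] vanishes. *)
Lemma le_mu_up (T : R) (gamma q phi : R -> R) (lam : R) :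
  0 < T -> (forall t, continuous gamma t) -> C1_per0 T q ->
  riccati_periodic T (fun t => centered T gamma t + lam) phi -> lam <= mu_up T gamma q.
Proof.
intros HT Cg [[Tq [Dq _]] Aq] [Tphi Hphi].
assert (Cq : forall t, continuous q t) by (intros; now apply (ex_derive_continuous q)).
assert (Cphi : forall t, continuous phi t) by (intros t; eapply is_derive_continuous, Hphi).
assert (Iq : RInt q 0 T = 0).
{ unfold average in Aq; apply Rmult_integral in Aq; destruct Aq as [H|H]; [|exact H].
  assert (H' := Rinv_0_lt_compat T HT); lra. }
assert (Cw := weight_continuous q Cq).
unfold mu_up; change (fun t => exp (- 2 * RInt q 0 t)) with (weight q).
set (R1 := fun t => exp _ * _).
assert (Cc := centered_continuous T gamma Cg).
assert (CR1 : forall t, continuous R1 t).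
{ intros t; apply (continuous_mult (weight q) (fun t => q t ^ 2 - centered T gamma t)); [apply Cw|].
  apply (continuous_minus (fun t => q t ^ 2) (centered T gamma)); [|apply Cc].
  apply (continuous_ext (fun t => mult (q t) (q t))).
  - intros s; change (q s * q s = q s ^ 2); ring.
  - now apply (continuous_mult q q). }
pose (dwp := fun t => weight q t * ((phi t ^ 2 + (centered T gamma t + lam)) - 2 * q t * phi t)).
assert (Cdwp : forall t, continuous dwp t).
{ intros t; apply (continuous_mult (weight q)); [apply Cw|].
  apply (continuous_ext (fun t => plus (mult (phi t) (plus (phi t) (mult (- 2) (q t))))
    (plus (centered T gamma t) lam))).
  - intros s; change (phi s * (phi s + - 2 * q s) + (centered T gamma s + lam) =
      phi s ^ 2 + (centered T gamma s + lam) - 2 * q s * phi s); ring.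
  - apply (continuous_plus (fun t => mult (phi t) (plus (phi t) (mult (- 2) (q t))))).
    + apply (continuous_mult phi); [apply Cphi|].
      apply (continuous_plus phi); [apply Cphi|].
      apply (continuous_mult (fun _ => - 2)); [apply continuous_const|apply Cq].
    + apply (continuous_plus (centered T gamma)); [apply Cc|apply continuous_const]. }
assert (E0 : RInt dwp 0 T = 0).
{ rewrite (RInt_of_derive (fun t => weight q t * phi t) dwp).
  - rewrite weight_0, weight_T by exact Iq.
    rewrite <- (Rplus_0_l T), Tphi; apply Rminus_diag.
  - intros t; apply is_derive_weight_mult; [exact Cq|apply Hphi].
  - exact Cdwp. }
assert (Ex : forall f : R -> R, (forall t, continuous f t) -> ex_RInt f 0 T).
{ intros f Hf; apply (@ex_RInt_continuous R_CompleteNormedModule); auto. }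
assert (Hw : 0 < RInt (weight q) 0 T).
{ apply RInt_gt_0; [exact HT| |]; intros; [apply weight_pos|apply Cw]. }
assert (Hle : lam * RInt (weight q) 0 T <= RInt R1 0 T + RInt dwp 0 T).
{ assert (E1 : RInt (fun t => lam * weight q t) 0 T = lam * RInt (weight q) 0 T)
    by (apply (RInt_scal (weight q)); auto).
  assert (E2 : RInt (fun t => R1 t + dwp t) 0 T = RInt R1 0 T + RInt dwp 0 T)
    by (apply (RInt_plus R1 dwp); auto).
  rewrite <- E1, <- E2; apply RInt_le; [lra| | |].
  - apply Ex; intros t; apply (continuous_mult (fun _ => lam)); [apply continuous_const|apply Cw].
  - apply Ex; intros t; apply (continuous_plus R1); auto.
  - intros t _; unfold R1, dwp; change (exp (- 2 * RInt q 0 t)) with (weight q t).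
    assert (H := weight_pos q t); assert (H' := pow2_ge_0 (q t - phi t)).
    assert (0 <= weight q t * (q t - phi t) ^ 2) by (apply Rmult_le_pos; lra).
    nra. }
rewrite E0, Rplus_0_r in Hle.
apply (Rmult_le_reg_l (RInt (weight q) 0 T)); [exact Hw|].
rewrite <- Rmult_assoc, Rinv_r by lra; lra.
Qed.

Lemma mu_low_max (T : R) (gamma p : R -> R) :
  0 < T -> (forall t, continuous gamma t) -> C1_per T p ->
  is_max (fun y => exists t, 0 <= t <= T /\ y = p t ^ 2 + centered T gamma t - Derive p t)
    (- mu_low T gamma p).
Proof.
intros HT Cg [Tp [Dp Cp]]; unfold mu_low; rewrite Ropp_involutive.
destruct (continuous_max (fun t => p t ^ 2 + centered T gamma t - Derive p t) T HT)
  as [s [Hs Hmax]].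
{ intros t.
  apply (continuous_minus (fun t => p t ^ 2 + centered T gamma t) (Derive p)); [|apply Cp].
  apply (continuous_plus (fun t => p t ^ 2)); [|now apply centered_continuous].
  assert (continuous p t) by now apply (ex_derive_continuous p).
  apply (continuous_ext (fun t => mult (p t) (p t))).
  - intros r; change (p r * p r = p r ^ 2); ring.
  - now apply (continuous_mult p p). }
apply set_max_correct with (p s ^ 2 + centered T gamma s - Derive p s).
split; [now exists s|]; intros y [t [Ht ->]]; now apply Hmax.
Qed.

Lemma mu_low_upper (T : R) (gamma p : R -> R) :
  0 < T -> (forall t, continuous gamma t) -> periodic T gamma -> C1_per T p ->
  upper_solution T (fun t => centered T gamma t + mu_low T gamma p) p.
Proof.
intros HT Cg Tg Hp; apply C1_per_upper; [exact Hp|]; intros t.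
destruct (mu_low_max T gamma p HT Cg Hp) as [_ H].
destruct Hp as [Tp [Dp _]].
destruct (periodic_representative T t HT) as [s [Hs Es]].
rewrite (Es p Tp), (Es _ (centered_periodic T gamma Tg)), (Es (Derive p)).
- specialize (H _ (ex_intro _ s (conj Hs eq_refl))); lra.
- apply (periodic_is_derive T p); [exact Tp|].
  intros; now apply Derive_correct.
Qed.

(** Along a solution the function whose maximum defines [mu_low] is constant. *)
Lemma mu_low_solution (T : R) (gamma phi : R -> R) (lam : R) :
  0 < T -> (forall t, continuous gamma t) ->
  riccati_periodic T (fun t => centered T gamma t + lam) phi -> mu_low T gamma phi = lam.
Proof.
intros HT Cg Hphi.
assert (C1 : C1_per T phi).
{ apply (riccati_periodic_C1 T) with (2 := Hphi).
  intros t; apply (continuous_plus (centered T gamma)); [now apply centered_continuous|].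
  apply continuous_const. }
destruct (mu_low_max T gamma phi HT Cg C1) as [[t [_ H]] _].
rewrite (is_derive_unique _ _ _ (proj2 Hphi t)) in H; lra.
Qed.

(** The zero-mean solution [phi] realizes [gamma_star] as its parameter. For a smaller
    average, [phi] is an upper solution, so there is a periodic solution; its mean
    cannot vanish by [upper_solution_parameter_le]. *)
Lemma discriminant_trichotomy (T : R) (gamma : R -> R) :
  0 < T -> periodic T gamma -> (forall t, continuous gamma t) ->
  let Delta := discriminant T gamma in
  (Delta > 0 -> exists y, riccati_periodic T gamma y /\ RInt y 0 T <> 0) /\
  (Delta = 0 -> exists y, riccati_periodic T gamma y /\ RInt y 0 T = 0) /\
  (Delta < 0 -> ~ exists y, riccati_periodic T gamma y) /\
  (forall p q, C1_per T p -> C1_per0 T q ->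
     mu_low T gamma p - average T gamma <= Delta /\
     Delta <= mu_up T gamma q - average T gamma).
Proof.
intros HT Tg Cg Delta.
assert (Cc := centered_continuous T gamma Cg).
assert (Tc := centered_periodic T gamma Tg).
destruct (principal_solution T (centered T gamma) HT Tc Cc) as [lam [phi [Hphi H0]]].
assert (Hmax : is_max (fun y => exists p, C1_per T p /\ y = mu_low T gamma p) lam).
{ split.
  - exists phi; split; [|now rewrite (mu_low_solution T gamma phi lam)].
    apply (riccati_periodic_C1 T) with (2 := Hphi).
    intros t; apply (continuous_plus (centered T gamma)); [apply Cc|apply continuous_const].
  - intros y [p [Hp ->]].
    exact (upper_solution_parameter_le T _ p phi _ _ HT
      (mu_low_upper T gamma p HT Cg Tg Hp) Hphi H0). }
assert (Egs : gamma_star T gamma = lam).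
{ destruct Hmax as [M1 M2]; destruct (set_max_correct _ lam (conj M1 M2)) as [N1 N2].
  apply Rle_antisym; [now apply M2|now apply N2]. }
assert (EDelta : Delta = lam - average T gamma).
{ unfold Delta, discriminant; now rewrite Egs. }
assert (Eg : gamma = fun t => centered T gamma t + average T gamma).
{ apply functional_extensionality; intros t; unfold centered; ring. }
split; [|split; [|split]].
- intros HD.
  destruct (periodic_bounded T gamma HT Tg Cg) as [G [HG Bg]].
  destruct (minimal_solution T (G + 1) gamma HT) with (q := phi) as [y [Hy _]]; auto.
  + lra.
  + intros t; specialize (Bg t); apply Rabs_le_between in Bg; nra.
  + apply (riccati_periodic_upper _ _ _ _ Hphi).
    intros t; unfold centered; lra.
  + exists y; split; [exact Hy|intros Hy0].
    assert (lam <= average T gamma); [|lra].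
    apply (upper_solution_parameter_le T (centered T gamma) phi y); auto.
    * apply (riccati_periodic_upper _ _ _ _ Hphi); intros t; lra.
    * now rewrite <- Eg.
- intros HD; exists phi; split; [|exact H0].
  rewrite Eg; replace (average T gamma) with lam by lra; exact Hphi.
- intros HD [y Hy].
  assert (average T gamma <= lam); [|lra].
  apply (upper_solution_parameter_le T (centered T gamma) y phi); auto.
  apply (riccati_periodic_upper _ _ _ _ Hy); intros t; unfold centered; lra.
- intros p q Hp Hq; split.
  + assert (mu_low T gamma p <= lam); [|lra].
    apply Hmax; now exists p.
  + assert (lam <= mu_up T gamma q); [|lra].
    now apply (le_mu_up T gamma q phi).
Qed.

(** * Uniqueness on an interval and zeros of Moebius displacements *)

(** Gronwall's argument on [w^2]. The functions are controlled on [[0, b]] only, so no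
    primitive of [c] is available beyond it; an upper bound of [c] is enough. *)
Lemma homogeneous_zero_on (c w : R -> R) (b : R) :
  (forall t, 0 <= t <= b -> continuous c t) ->
  (forall t, 0 <= t <= b -> is_derive w t (c t * w t)) -> w 0 = 0 ->
  forall t, 0 <= t <= b -> w t = 0.
Proof.
intros Cc Dw W0 t Ht.
destruct (continuity_ab_maj c 0 b) as [s [Hs _]]; [lra| |].
{ intros r Hr; apply continuity_pt_filterlim, Cc, Hr. }
assert (H : - (w 0 ^ 2 * exp (- 2 * c s * 0)) <= - (w t ^ 2 * exp (- 2 * c s * t))).
{ apply (is_derive_nonneg_incr (fun t => - (w t ^ 2 * exp (- 2 * c s * t)))
    (fun t => 2 * (c s - c t) * (w t ^ 2 * exp (- 2 * c s * t)))); [| |lra].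
  - intros r Hr; assert (D := Dw r ltac:(lra)).
    auto_derive; [exact (ex_intro _ _ D)|].
    derive_known D; ring.
  - intros r Hr; specialize (Hs r ltac:(lra)).
    assert (0 <= w r ^ 2 * exp (- 2 * c s * r)).
    { apply Rmult_le_pos; [apply pow2_ge_0|left; apply exp_pos]. }
    apply Rmult_le_pos; lra. }
rewrite W0 in H.
assert (He := exp_pos (- 2 * c s * t)).
assert (0 <= w t ^ 2) by apply pow2_ge_0.
assert (w t ^ 2 = 0) by nra; nra.
Qed.

Lemma nonvanishing_sign (a : R -> R) :
  (forall t, continuous a t) -> (forall t, a t <> 0) ->
  exists s, (s = 1 \/ s = -1) /\ forall t, 0 < s * a t.
Proof.
intros Ca Ha.
assert (Hsame : forall t, 0 < a 0 * a t).
{ intros t; apply Rnot_le_lt; intros H.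
  assert (H0 := Ha 0); assert (Ht := Ha t).
  destruct (IVT_gen a 0 t 0) as [r [_ Hr]].
  - intros x; apply continuity_pt_filterlim, Ca.
  - unfold Rmin, Rmax; destruct (Rle_dec (a 0) (a t)); nra.
  - exact (Ha r Hr). }
destruct (Rle_lt_dec 0 (a 0)) as [H|H].
- exists 1; split; [now left|]; intros t; specialize (Hsame t); nra.
- exists (-1); split; [now right|]; intros t; specialize (Hsame t); nra.
Qed.

(** Near [c] the derivative of [g] is [M / (1 - (y - c) B)^2 - 1], and the second
    derivative is [2 M B / (1 - (y - c) B)^3]: the multiplicity is read off from the
    values [M - 1] and [2 M B] at [c]. *)
Lemma mobius_zero_mult (g : R -> R) (c M B delta : R) :
  0 < delta ->
  (forall y, Rabs (y - c) < delta -> 0 < 1 - (y - c) * B) ->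
  (forall y, Rabs (y - c) < delta -> g y = (y - c) * M / (1 - (y - c) * B) - (y - c)) ->
  (M <> 1 -> zero_of_mult g c 1) /\ (M = 1 -> B <> 0 -> zero_of_mult g c 2).
Proof.
intros Hd Hpos Hg.
pose (ball_c := fun y => Rabs (y - c) < delta).
assert (Hball : forall y, ball_c y -> locally y ball_c).
{ intros y Hy; unfold ball_c in Hy.
  assert (H : 0 < delta - Rabs (y - c)) by lra.
  exists (mkposreal _ H); intros x Hx.
  change (Rabs (x - y) < delta - Rabs (y - c)) in Hx; unfold ball_c.
  replace (x - c) with ((x - y) + (y - c)) by ring.
  assert (H' := Rabs_triang (x - y) (y - c)); lra. }
assert (Hc : ball_c c) by (unfold ball_c; rewrite Rminus_diag, Rabs_R0; exact Hd).
assert (D1 : forall y, ball_c y -> is_derive g y (M / (1 - (y - c) * B) ^ 2 - 1)).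
{ intros y Hy; assert (Hp := Hpos y Hy).
  apply (is_derive_ext_loc (fun y => (y - c) * M / (1 - (y - c) * B) - (y - c))).
  - apply filter_imp with (2 := Hball y Hy); intros x Hx; now rewrite (Hg x Hx).
  - auto_derive; [lra|field; lra]. }
assert (D2 : forall y, ball_c y -> is_derive (Derive g) y (2 * M * B / (1 - (y - c) * B) ^ 3)).
{ intros y Hy; assert (Hp := Hpos y Hy).
  apply (is_derive_ext_loc (fun y => M / (1 - (y - c) * B) ^ 2 - 1)).
  - apply filter_imp with (2 := Hball y Hy); intros x Hx.
    symmetry; apply is_derive_unique, D1, Hx.
  - assert (0 < (1 - (y - c) * B) ^ 2) by (apply pow_lt; lra).
    auto_derive; [intros H'; nra|field; lra]. }
assert (G0 : g c = 0) by (rewrite (Hg c Hc), Rminus_diag; unfold Rdiv; ring).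
assert (G1 : Derive g c = M - 1).
{ rewrite (is_derive_unique _ _ _ (D1 c Hc)), Rminus_diag; field. }
assert (G2 : Derive (Derive g) c = 2 * M * B).
{ rewrite (is_derive_unique _ _ _ (D2 c Hc)), Rminus_diag; field. }
split.
- intros HM; split; [|split].
  + apply filter_imp with (2 := Hball c Hc); intros y Hy [|[|j]] Hj; [easy| |lia].
    eexists; now apply D1.
  + intros [|j] Hj; [exact G0|lia].
  + change (Derive g c <> 0); lra.
- intros HM HB; split; [|split].
  + apply filter_imp with (2 := Hball c Hc); intros y Hy [|[|[|j]]] Hj; [easy| | |lia].
    * eexists; now apply D1.
    * eexists; now apply D2.
  + intros [|[|j]] Hj; [exact G0| |lia].
    change (Derive g c = 0); lra.
  + change (Derive (Derive g) c <> 0); rewrite G2, HM; lra.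
Qed.

(** * Solutions of a Riccati equation around a given periodic one *)

Section Riccati.

Context (T : R) (a0 a1 a2 phi : R -> R).
Context (HT : 0 < T) (C1 : forall t, continuous a1 t) (C2 : forall t, continuous a2 t).
Context (T1 : periodic T a1) (T2 : periodic T a2) (Ha2 : forall t, a2 t <> 0).

Notation f := (riccati a0 a1 a2).

Context (Hphi : periodic_solution f T phi).

(** The coefficient of the linearized equation along [phi]. *)
Definition variation (t : R) : R := 2 * a2 t * phi t + a1 t.
Definition growth (t : R) : R := exp (RInt variation 0 t).
Definition growth_primitive (t : R) : R := RInt (fun s => a2 s * growth s) 0 t.
(** The solution with initial value [phi 0 + z]: the difference to [phi] satisfies the
    Bernoulli equation [u' = variation u + a2 u^2], which is linear in [1 / u]. *)
Definition flow (z t : R) : R := phi t + z * growth t / (1 - z * growth_primitive t).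

Notation m := variation.
Notation E := growth.
Notation F := growth_primitive.

Lemma phi_continuous t : continuous phi t.
Proof. eapply is_derive_continuous, (proj1 Hphi t I). Qed.

Lemma variation_continuous t : continuous m t.
Proof.
apply (continuous_plus (fun t => 2 * a2 t * phi t) a1); [|apply C1].
apply (continuous_mult (fun t => 2 * a2 t) phi); [|apply phi_continuous].
apply (continuous_mult (fun _ => 2) a2); [apply continuous_const|apply C2].
Qed.

Lemma is_derive_growth t : is_derive E t (m t * E t).
Proof.
unfold growth; assert (H := is_derive_primitive m t variation_continuous).
set (B := fun x => RInt m 0 x) in *.
change (is_derive (fun x => exp (B x)) t (m t * exp (B t))).
clearbody B; auto_derive; [exact (ex_intro _ _ H)|].
derive_known H; ring.
Qed.

Lemma growth_continuous t : continuous E t.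
Proof. eapply is_derive_continuous, is_derive_growth. Qed.

Lemma is_derive_growth_primitive t : is_derive F t (a2 t * E t).
Proof.
apply (is_derive_primitive (fun s => a2 s * E s)); intros s.
apply (continuous_mult a2); [apply C2|apply growth_continuous].
Qed.

Lemma growth_pos t : 0 < E t.
Proof. apply exp_pos. Qed.

Lemma growth_0 : E 0 = 1.
Proof. unfold growth; rewrite RInt_point_R; apply exp_0. Qed.

Lemma growth_primitive_0 : F 0 = 0.
Proof. apply RInt_point_R. Qed.

Lemma flow_0 z : flow z 0 = phi 0 + z.
Proof. unfold flow; rewrite growth_0, growth_primitive_0; field. Qed.

Lemma growth_primitive_T_neq_0 : F T <> 0.
Proof.
destruct (mean_value F (fun t => a2 t * E t) 0 T) as [c [_ H]].
{ intros; apply is_derive_growth_primitive. }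
rewrite growth_primitive_0 in H.
assert (H1 := Ha2 c); assert (H2 := growth_pos c).
replace (F T) with (a2 c * E c * T) by lra.
repeat apply Rmult_integral_contrapositive_currified; lra.
Qed.

Lemma flow_solves z t : 1 - z * F t <> 0 -> is_derive (flow z) t (f t (flow z t)).
Proof.
intros H; unfold flow.
assert (D1 := proj1 Hphi t I); assert (D2 := is_derive_growth t).
assert (D3 := is_derive_growth_primitive t).
auto_derive; [repeat split; try (eexists; eauto); exact H|].
derive_known D1; derive_known D2; derive_known D3.
unfold riccati, variation; field; exact H.
Qed.

(** The defect [(x - phi)(1 - z F) - z E], with [z = x 0 - phi 0], satisfies a linear
    homogeneous equation and vanishes at [0]. Where [1 - z F] vanished, [z E] would
    vanish too, so the denominator keeps its initial sign as long as [x] exists. *)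
Lemma flow_unique x b : 0 <= b -> solves_on f (fun t => 0 <= t <= b) x ->
  forall t, 0 <= t <= b ->
    0 < 1 - (x 0 - phi 0) * F t /\
    (x t - phi t) * (1 - (x 0 - phi 0) * F t) = (x 0 - phi 0) * E t.
Proof.
intros Hb Hx; set (z := x 0 - phi 0).
assert (HW : forall t, 0 <= t <= b -> (x t - phi t) * (1 - z * F t) - z * E t = 0).
{ apply (homogeneous_zero_on (fun t => m t + a2 t * (x t - phi t))).
  - intros t Ht.
    apply (continuous_plus m); [apply variation_continuous|].
    apply (continuous_mult a2); [apply C2|].
    apply (continuous_minus x phi); [|apply phi_continuous].
    eapply is_derive_continuous, (Hx t Ht).
  - intros t Ht.
    assert (D0 := Hx t Ht).
    assert (D1 := proj1 Hphi t I); assert (D2 := is_derive_growth t).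
    assert (D3 := is_derive_growth_primitive t).
    auto_derive; [repeat split; eexists; eauto|].
    derive_known D0; derive_known D1; derive_known D2; derive_known D3.
    unfold riccati, variation; ring.
  - rewrite growth_0, growth_primitive_0; unfold z; ring. }
intros t Ht; split; [|specialize (HW t Ht); lra].
apply Rnot_le_lt; intros Hneg.
destruct (IVT_gen (fun t => 1 - z * F t) 0 t 0) as [r [Hr1 Hr2]].
- intros s; apply continuity_pt_filterlim.
  apply (continuous_minus (fun _ => 1) (fun t => z * F t)); [apply continuous_const|].
  apply (continuous_mult (fun _ => z) F); [apply continuous_const|].
  eapply is_derive_continuous, is_derive_growth_primitive.
- rewrite growth_primitive_0; unfold Rmin, Rmax; destruct (Rle_dec _ _); lra.
- rewrite Rmin_left, Rmax_right in Hr1 by lra.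
  assert (H := HW r ltac:(lra)); cbv beta in Hr2; rewrite Hr2 in H.
  assert (Hz : z = 0) by (assert (HE := growth_pos r); nra).
  rewrite Hz in Hr2; lra.
Qed.

Lemma displacement_eq z : (forall t, 0 <= t <= T -> 0 < 1 - z * F t) ->
  displacement_dom f T (phi 0 + z) /\
  displacement f T (phi 0 + z) = z * E T / (1 - z * F T) - z.
Proof.
intros Hz.
assert (TphiT : phi T = phi 0) by (rewrite <- (Rplus_0_l T); apply Hphi).
assert (H : displacement_rel f T (phi 0 + z) (z * E T / (1 - z * F T) - z)).
{ exists (flow z); split; [|split].
  - intros t Ht; apply flow_solves; specialize (Hz t Ht); lra.
  - apply flow_0.
  - unfold flow; rewrite TphiT; ring. }
split; [now eexists; exact H|].
unfold displacement.
apply (@iota_unique _ R_CompleteNormedModule); [|exact H].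
intros d [x [Hx [Hx0 ->]]].
destruct (flow_unique x T (Rlt_le _ _ HT) Hx T) as [Hp Hu]; [lra|].
rewrite Hx0, TphiT in Hu.
replace (phi 0 + z - phi 0) with z in * by ring.
specialize (Hz T ltac:(lra)).
replace (z * E T) with ((x T - phi 0) * (1 - z * F T)) by exact Hu.
change ((x T - (phi 0 + z)) = (x T - phi 0) * (1 - z * F T) / (1 - z * F T) - z).
field; lra.
Qed.

Lemma cycle_mult :
  (E T <> 1 -> hyperbolic f T phi) /\ (E T = 1 -> double_cycle f T phi).
Proof.
destruct (continuous_max (fun t => Rabs (F t)) T HT) as [s [_ Hs]].
{ intros t; apply (continuous_comp F Rabs); [|apply continuous_Rabs].
  eapply is_derive_continuous, is_derive_growth_primitive. }
assert (HB := Rabs_pos (F s)).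
assert (Hd : 0 < / (Rabs (F s) + 1)) by (apply Rinv_0_lt_compat; lra).
set (d := / (Rabs (F s) + 1)) in *.
assert (Hz : forall z, Rabs z < d -> forall t, 0 <= t <= T -> 0 < 1 - z * F t).
{ intros z Hz t Ht; specialize (Hs t Ht).
  assert (Hp := Rabs_pos z).
  assert (Rabs (z * F t) < 1).
  { rewrite Rabs_mult.
    apply Rle_lt_trans with (Rabs z * (Rabs (F s) + 1)).
    - apply Rmult_le_compat_l; lra.
    - apply Rlt_le_trans with (d * (Rabs (F s) + 1)); [apply Rmult_lt_compat_r; lra|].
      right; unfold d; field; lra. }
  assert (Hle := Rle_abs (z * F t)); lra. }
assert (Hdom : locally (phi 0) (displacement_dom f T)).
{ exists (mkposreal d Hd); intros y Hy.
  change (Rabs (y - phi 0) < d) in Hy.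
  replace y with (phi 0 + (y - phi 0)) by ring.
  now apply displacement_eq, Hz. }
destruct (mobius_zero_mult (displacement f T) (phi 0) (E T) (F T) d Hd) as [H1 H2].
{ intros y Hy; apply (Hz _ Hy); lra. }
{ intros y Hy.
  replace (displacement f T y) with (displacement f T (phi 0 + (y - phi 0)))
    by (f_equal; ring).
  now apply displacement_eq, Hz. }
split; intros HE; split; auto.
apply H2; [exact HE|apply growth_primitive_T_neq_0].
Qed.

(** The fixed-point equation [z = z E(T) / (1 - z F(T))] of the period map. *)
Lemma periodic_solution_values psi : periodic_solution f T psi ->
  psi 0 = phi 0 \/ (psi 0 - phi 0) * F T = 1 - E T.
Proof.
intros [Hpsi Tpsi].
destruct (flow_unique psi T (Rlt_le _ _ HT)) with (t := T) as [_ H]; [|lra|].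
{ intros t _; now apply Hpsi. }
rewrite <- (Rplus_0_l T) in H at 1 2; rewrite Tpsi, (proj2 Hphi) in H.
destruct (Req_dec (psi 0) (phi 0)) as [H0|H0]; [now left|right].
apply (Rmult_eq_reg_l (psi 0 - phi 0)); lra.
Qed.

Lemma periodic_solution_eq psi : periodic_solution f T psi -> psi 0 = phi 0 -> psi = phi.
Proof.
intros [Hpsi Tpsi] H0; apply functional_extensionality; intros t.
destruct (periodic_representative T t HT) as [s [Hs Es]].
rewrite (Es psi Tpsi), (Es phi (proj2 Hphi)).
destruct (flow_unique psi T (Rlt_le _ _ HT)) with (t := s) as [_ H]; [|lra|].
{ intros r _; now apply Hpsi. }
rewrite H0 in H; lra.
Qed.

Lemma growth_translate t : E (t + T) = E T * E t.
Proof.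
assert (Hm : forall t, m (t + T) = m t).
{ intros s; unfold variation; now rewrite T1, T2, (proj2 Hphi). }
assert (H := homogeneous_solution m (fun t => RInt m 0 t) (fun t => E (t + T))
  (fun t => is_derive_primitive m t variation_continuous)).
cbv beta in H; rewrite H.
- rewrite Rplus_0_l, RInt_point_R, Rminus_0_r; reflexivity.
- intros s; rewrite <- Hm; apply is_derive_shift, is_derive_growth.
Qed.

Lemma growth_primitive_translate t : F (t + T) = F T + E T * F t.
Proof.
assert (H : F (t + T) - E T * F t = F (0 + T) - E T * F 0).
{ apply (is_derive_zero_const (fun t => F (t + T) - E T * F t)); intros s.
  apply is_derive_eq with (minus (a2 (s + T) * E (s + T)) (E T * (a2 s * E s))).
  - apply (is_derive_minus (fun t => F (t + T)) (fun t => E T * F t)).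
    + apply is_derive_shift, is_derive_growth_primitive.
    + apply (is_derive_scal F), is_derive_growth_primitive.
  - rewrite T2, growth_translate.
    change (a2 s * (E T * E s) - E T * (a2 s * E s) = 0); ring. }
rewrite growth_primitive_0, Rplus_0_l in H; lra.
Qed.

Lemma growth_primitive_monotone (s u v : R) :
  (forall t, 0 < s * a2 t) -> u <= v -> s * F u <= s * F v.
Proof.
intros Hs; apply (is_derive_nonneg_incr (fun t => s * F t) (fun t => s * (a2 t * E t))).
- intros t _; apply (is_derive_scal F), is_derive_growth_primitive.
- intros t _; specialize (Hs t); assert (H := growth_pos t); nra.
Qed.

(** Both [1 - z F] and [E] are multiplied by [E(T)] over a period, so their quotient is
    periodic. It is positive on [[0, T]], where [1 - z F] is a convex combination
    of [1] and [E(T)] because [F] is monotone there. *)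
Lemma second_periodic_solution : E T <> 1 ->
  periodic_solution f T (flow ((1 - E T) / F T)).
Proof.
intros HM; set (z := (1 - E T) / F T).
assert (HF := growth_primitive_T_neq_0).
assert (EM := growth_pos T).
assert (Ez : z * F T = 1 - E T) by (unfold z; field; exact HF).
pose (g := fun t => (1 - z * F t) / E t).
assert (Tg : periodic T g).
{ intros t; unfold g; rewrite growth_primitive_translate, growth_translate.
  replace (1 - z * (F T + E T * F t)) with (E T * (1 - z * F t)) by (ring_simplify; lra).
  field; split; apply Rgt_not_eq, growth_pos. }
assert (Hg0 : forall t, 0 <= t <= T -> 0 < g t).
{ intros t Ht.
  destruct (nonvanishing_sign a2 C2 Ha2) as [s [Hs1 Hs]].
  assert (M1 := growth_primitive_monotone s 0 t Hs ltac:(lra)).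
  assert (M2 := growth_primitive_monotone s t T Hs ltac:(lra)).
  rewrite growth_primitive_0, Rmult_0_r in M1.
  apply Rdiv_lt_0_compat; [|apply growth_pos].
  assert (HsF : 0 < s * F T).
  { destruct (Rle_lt_or_eq_dec 0 (s * F T)) as [H|H]; [lra|exact H|].
    symmetry in H; apply Rmult_integral in H; destruct H; [lra|contradiction]. }
  apply (Rmult_lt_reg_l (s * F T)); [exact HsF|].
  rewrite Rmult_0_r.
  replace (s * F T * (1 - z * F t)) with ((s * F T - s * F t) + E T * (s * F t)).
  - destruct (Rle_lt_or_eq_dec _ _ M1); nra.
  - replace (s * F T * (1 - z * F t)) with (s * F T - (z * F T) * (s * F t)) by ring.
    rewrite Ez; ring. }
assert (Hg : forall t, 0 < g t).
{ intros t; destruct (periodic_representative T t HT) as [r [Hr Er]].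
  rewrite (Er g Tg); now apply Hg0. }
assert (Hnz : forall t, 1 - z * F t <> 0).
{ intros t H; specialize (Hg t); unfold g in Hg; rewrite H in Hg; unfold Rdiv in Hg; lra. }
split.
- intros t _; apply flow_solves, Hnz.
- assert (Efl : forall t, flow z t = phi t + z / g t).
  { intros t; unfold flow, g; field; split; [apply Rgt_not_eq, growth_pos|apply Hnz]. }
  intros t; now rewrite !Efl, Tg, (proj2 Hphi).
Qed.

(** [E] is periodic, hence bounded above and away from [0], and [|F|] grows at least
    linearly. On the side where [z F < 0] the denominator [1 - z F] tends to infinity
    and the solution tends to [phi]; on the other side the denominator decreases
    through every value between [1] and [0], and small values put the solution far from
    [phi]. *)
Lemma semi_stable_of_growth : E T = 1 -> semi_stable f phi.
Proof.
intros HM.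
destruct (nonvanishing_sign a2 C2 Ha2) as [s [Hs1 Hs]].
assert (Hss : s * s = 1) by (destruct Hs1; subst; ring).
assert (TE : periodic T E) by (intros t; rewrite growth_translate, HM; ring).
destruct (periodic_max T E HT TE growth_continuous) as [u Hu].
destruct (periodic_min T E HT TE growth_continuous) as [v Hv].
assert (Ev := growth_pos v).
assert (Hlin : exists c, 0 < c /\ forall t, 0 <= t -> c * t <= s * F t).
{ destruct (periodic_min T (fun t => s * a2 t * E t) HT) as [r Hr].
  - intros t; now rewrite T2, TE.
  - intros t; apply (continuous_mult (fun t => s * a2 t) E); [|apply growth_continuous].
    apply (continuous_mult (fun _ => s) a2); [apply continuous_const|apply C2].
  - exists (s * a2 r * E r); split.
    + apply Rmult_lt_0_compat; [apply Hs|apply growth_pos].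
    + intros t Ht.
      assert (H : s * F 0 - s * a2 r * E r * 0 <= s * F t - s * a2 r * E r * t).
      { apply (is_derive_nonneg_incr (fun t => s * F t - s * a2 r * E r * t)
          (fun t => s * (a2 t * E t) - s * a2 r * E r)); [| |exact Ht].
        - intros x _.
          apply (is_derive_minus (fun t => s * F t)).
          + apply (is_derive_scal F), is_derive_growth_primitive.
          + auto_derive; [easy|ring].
        - intros x _; specialize (Hr x); lra. }
      rewrite growth_primitive_0 in H; lra. }
destruct Hlin as [c [Hc Hlin]].
exists (- s); split; [destruct Hs1; subst; [right|left]; lra|split].
- exists 1; split; [lra|]; intros x0 [Hx0 _].
  set (z := x0 - phi 0) in *.
  assert (Hg : forall t, 0 <= t -> 1 + (- s * z) * (c * t) <= 1 - z * F t).
  { intros t Ht; specialize (Hlin t Ht).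
    replace (z * F t) with (s * z * (s * F t)).
    - nra.
    - replace (s * z * (s * F t)) with (s * s * (z * F t)) by ring; rewrite Hss; ring. }
  exists (flow z); split; [|split].
  + intros t Ht; apply flow_solves; specialize (Hg t Ht).
    assert (0 <= - s * z * (c * t)) by (apply Rmult_le_pos; [lra|apply Rmult_le_pos; lra]); lra.
  + rewrite flow_0; unfold z; ring.
  + apply is_lim_spec; intros eps; exists (E u / (c * eps)); intros t Ht.
    assert (He := cond_pos eps).
    assert (HEu := growth_pos u).
    assert (Hce : 0 < c * eps) by now apply Rmult_lt_0_compat.
    assert (Hq : 0 < E u / (c * eps)) by now apply Rdiv_lt_0_compat.
    assert (Ht0 : 0 < t) by lra.
    specialize (Hg t ltac:(lra)).
    assert (Hcz : 0 < - s * z * (c * t)) 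
      by (apply Rmult_lt_0_compat; [lra|now apply Rmult_lt_0_compat]).
    assert (Az : Rabs z = - s * z).
    { destruct Hs1; subst s; [rewrite Rabs_left|rewrite Rabs_right]; lra. }
    unfold flow.
    replace (phi t + z * E t / (1 - z * F t) - phi t - 0)
      with (z * E t / (1 - z * F t)) by ring.
    unfold Rdiv; rewrite !Rabs_mult, Rabs_inv, Az.
    rewrite (Rabs_right (E t)) by (left; apply growth_pos).
    rewrite (Rabs_right (1 - z * F t)) by lra.
    apply (Rmult_lt_reg_r (1 - z * F t)); [lra|].
    rewrite Rmult_assoc, Rinv_l, Rmult_1_r by lra.
    apply Rle_lt_trans with (- s * z * E u); [apply Rmult_le_compat_l; [lra|apply Hu]|].
    apply Rlt_le_trans with (eps * (- s * z * (c * t))).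
    * assert (E u < c * eps * t).
      { apply (Rmult_lt_compat_l (c * eps)) in Ht; [|exact Hce].
        replace (c * eps * (E u / (c * eps))) with (E u) in Ht by (field; lra); exact Ht. }
      replace (eps * (- s * z * (c * t))) with (- s * z * (c * eps * t)) by ring.
      apply Rmult_lt_compat_l; lra.
    * apply Rmult_le_compat_l; lra.
- exists 1; split; [lra|]; intros x0 Hx0.
  set (z := x0 - phi 0) in *.
  replace (- - s * z) with (s * z) in Hx0 by ring.
  assert (EzF : forall t, z * F t = s * z * (s * F t)).
  { intros t; replace (s * z * (s * F t)) with (s * s * (z * F t)) by ring.
    rewrite Hss; ring. }
  assert (Ev1 : E v <= 1) by (rewrite <- growth_0; apply Hv).
  (* The denominator is brought down to [eta], the value at which the smallest
     possible numerator [|z| E v] makes the distance to [phi] equal to [1]. *)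
  set (eta := s * z * E v).
  assert (Heta : 0 < eta <= 1) by (unfold eta; nra).
  assert (Hb0 : 0 < / (s * z * c)) by (apply Rinv_0_lt_compat, Rmult_lt_0_compat; lra).
  destruct (IVT_gen (fun t => z * F t) 0 (/ (s * z * c)) (1 - eta)) as [b [Hb Eb]].
  + intros t; apply continuity_pt_filterlim.
    apply (continuous_mult (fun _ => z) F); [apply continuous_const|].
    eapply is_derive_continuous, is_derive_growth_primitive.
  + rewrite growth_primitive_0, Rmult_0_r.
    assert (H : 1 <= z * F (/ (s * z * c))).
    { rewrite EzF; specialize (Hlin _ (Rlt_le _ _ Hb0)).
      apply (Rmult_le_compat_l (s * z)) in Hlin; [|lra].
      rewrite <- Rmult_assoc, Rinv_r in Hlin; [exact Hlin|].
      apply Rgt_not_eq, Rmult_lt_0_compat; lra. }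
    rewrite Rmin_left, Rmax_right; lra.
  + rewrite Rmin_left, Rmax_right in Hb by lra; cbv beta in Eb.
    assert (Hg : forall t, 0 <= t <= b -> eta <= 1 - z * F t).
    { intros t Ht; assert (M := growth_primitive_monotone s t b Hs ltac:(lra)).
      rewrite EzF in Eb |- *; nra. }
    exists b, (flow z); split; [lra|split; [|split]].
    * intros t Ht; apply flow_solves; specialize (Hg t Ht); lra.
    * rewrite flow_0; unfold z; ring.
    * unfold flow; rewrite Eb.
      replace (phi b + z * E b / (1 - (1 - eta)) - phi b) with (z * E b / eta) by (field; lra).
      assert (Az : Rabs z = s * z).
      { destruct Hs1; subst s; [rewrite Rabs_right|rewrite Rabs_left]; lra. }
      unfold Rdiv; rewrite !Rabs_mult, Rabs_inv, Az.
      rewrite (Rabs_right (E b)) by (left; apply growth_pos).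
      rewrite (Rabs_right eta) by lra.
      apply (Rmult_le_reg_r eta); [lra|].
      rewrite Rmult_assoc, Rinv_l, Rmult_1_r by lra.
      unfold eta; rewrite Rmult_1_l; apply Rmult_le_compat_l; [lra|apply Hv].
Qed.

End Riccati.

(** * Limit cycles among finitely many periodic solutions *)

Lemma limit_cycles_one (f : R -> R -> R) (T : R) (phi : R -> R) :
  periodic_solution f T phi -> (forall psi, periodic_solution f T psi -> psi = phi) ->
  forall psi, limit_cycle f T psi <-> psi = phi.
Proof.
intros Hphi Hu psi; split.
- intros [H _]; now apply Hu.
- intros ->; split; [exact Hphi|]; exists 1; split; [lra|]; intros chi Hchi _; now apply Hu.
Qed.

Lemma limit_cycles_two (f : R -> R -> R) (T : R) (phi1 phi2 : R -> R) :
  periodic_solution f T phi1 -> periodic_solution f T phi2 -> phi1 0 <> phi2 0 ->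
  (forall psi, periodic_solution f T psi -> psi = phi1 \/ psi = phi2) ->
  forall psi, limit_cycle f T psi <-> psi = phi1 \/ psi = phi2.
Proof.
intros H1 H2 Hne Hu psi; split.
- intros [H _]; now apply Hu.
- assert (He : 0 < Rabs (phi1 0 - phi2 0)) by (apply Rabs_pos_lt; lra).
  intros [-> | ->]; (split; [assumption|]);
    exists (Rabs (phi1 0 - phi2 0)); (split; [exact He|]);
    intros chi Hchi Hd; destruct (Hu chi Hchi) as [-> | ->]; auto; specialize (Hd 0).
  + rewrite Rabs_minus_sym in Hd; lra.
  + lra.
Qed.

(** * Reduction to the normal form *)

Section Reduction.

Context (T : R) (a0 a1 a2 : R -> R).
Context (Hs0 : smooth a0) (Hs1 : smooth a1) (Hs2 : smooth a2)
  (Hp0 : periodic T a0) (Hp1 : periodic T a1) (Hp2 : periodic T a2)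
  (Ha2 : forall t, a2 t <> 0).

Notation A := (riccati_A a1 a2).

Lemma smooth_ex_derive (a : R -> R) : smooth a -> forall t, ex_derive a t.
Proof. intros H t; exact (H 1%nat t). Qed.

Lemma smooth_Derive (a : R -> R) : smooth a -> smooth (Derive a).
Proof.
intros H [|n] t; [easy|].
apply (ex_derive_ext (Derive_n a (S n))); [|exact (H (S (S n)) t)].
intros s; now rewrite <- Nat.add_1_r, <- (Derive_n_comp a n 1).
Qed.

Lemma periodic_Derive (a : R -> R) : smooth a -> periodic T a -> periodic T (Derive a).
Proof.
intros H Ta; apply (periodic_is_derive T a); [exact Ta|].
intros t; now apply Derive_correct, smooth_ex_derive.
Qed.

Lemma is_derive_riccati_A t :
  is_derive A t (1 / 2 * (Derive a1 t
    + (Derive (Derive a2) t * a2 t - Derive a2 t * Derive a2 t) / (a2 t * a2 t))).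
Proof.
assert (D1 := smooth_ex_derive _ Hs1 t).
assert (D2 := smooth_ex_derive _ Hs2 t).
assert (D3 := smooth_ex_derive _ (smooth_Derive _ Hs2) t).
unfold riccati_A; auto_derive; [now repeat split|].
change (Derive (fun x => a1 x) t) with (Derive a1 t).
change (Derive (fun x => a2 x) t) with (Derive a2 t).
change (Derive (fun x => Derive a2 x) t) with (Derive (Derive a2) t).
field; apply Ha2.
Qed.

Lemma riccati_gamma_continuous t : continuous (riccati_gamma a0 a1 a2) t.
Proof.
apply (continuous_ext (fun t => a2 t * a0 t - A t ^ 2 + 1 / 2 * (Derive a1 t
    + (Derive (Derive a2) t * a2 t - Derive a2 t * Derive a2 t) / (a2 t * a2 t)))).
{ intros s; unfold riccati_gamma.
  now rewrite (is_derive_unique _ _ _ (is_derive_riccati_A s)). }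
assert (D0 := smooth_ex_derive _ Hs0 t).
assert (D1 := smooth_ex_derive _ Hs2 t).
assert (D2 := smooth_ex_derive _ (smooth_Derive _ Hs1) t).
assert (D3 := smooth_ex_derive _ (smooth_Derive _ Hs2) t).
assert (D4 := smooth_ex_derive _ (smooth_Derive _ (smooth_Derive _ Hs2)) t).
assert (DA : ex_derive A t) by (eexists; apply is_derive_riccati_A).
apply (ex_derive_continuous (K := R_AbsRing) (V := R_NormedModule)).
assert (H := Ha2 t).
auto_derive; repeat split; auto.
Qed.

Lemma riccati_A_periodic : periodic T A.
Proof.
intros t; unfold riccati_A.
now rewrite Hp1, Hp2, (periodic_Derive a2 Hs2 Hp2).
Qed.

Lemma riccati_gamma_periodic : periodic T (riccati_gamma a0 a1 a2).
Proof.
intros t; unfold riccati_gamma.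
rewrite Hp0, Hp2, riccati_A_periodic, (periodic_is_derive T A (Derive A)); [easy| |].
- exact riccati_A_periodic.
- intros s; apply Derive_correct; eexists; apply is_derive_riccati_A.
Qed.

Lemma riccati_periodic_of_solution x :
  periodic_solution (riccati a0 a1 a2) T x ->
  riccati_periodic T (riccati_gamma a0 a1 a2) (fun t => a2 t * x t + A t).
Proof.
intros [Hx Tx]; split; [intros t; now rewrite Hp2, Tx, riccati_A_periodic|].
intros t; specialize (Hx t I).
assert (D2 := Derive_correct _ _ (smooth_ex_derive _ Hs2 t)).
assert (DA := Derive_correct A t ltac:(eexists; apply is_derive_riccati_A)).
auto_derive; [repeat split; eexists; eauto|].
derive_known Hx.
change (Derive (fun x => A x) t) with (Derive A t).
change (Derive (fun x => a2 x) t) with (Derive a2 t).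
unfold riccati_gamma; set (dA := Derive A t).
replace (a1 t) with (2 * A t - Derive a2 t / a2 t) by (unfold riccati_A; field; apply Ha2).
unfold riccati.
replace (a1 t) with (2 * A t - Derive a2 t / a2 t) by (unfold riccati_A; field; apply Ha2).
field; apply Ha2.
Qed.

Lemma solution_of_riccati_periodic y :
  riccati_periodic T (riccati_gamma a0 a1 a2) y ->
  periodic_solution (riccati a0 a1 a2) T (fun t => (y t - A t) / a2 t).
Proof.
intros [Ty Hy]; split; [|intros t; now rewrite Hp2, Ty, riccati_A_periodic].
intros t _; specialize (Hy t).
assert (D2 := Derive_correct _ _ (smooth_ex_derive _ Hs2 t)).
assert (DA := Derive_correct A t ltac:(eexists; apply is_derive_riccati_A)).
auto_derive; [repeat split; try (eexists; eauto); apply Ha2|].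
derive_known Hy.
change (Derive (fun x => A x) t) with (Derive A t).
change (Derive (fun x => a2 x) t) with (Derive a2 t).
unfold riccati_gamma; set (dA := Derive A t).
unfold riccati.
replace (a1 t) with (2 * A t - Derive a2 t / a2 t) by (unfold riccati_A; field; apply Ha2).
field; apply Ha2.
Qed.

(** [growth * a2] and [exp (2 int y)] satisfy the same linear equation, and [a2] is
    periodic. *)
Lemma growth_of_solution y :
  riccati_periodic T (riccati_gamma a0 a1 a2) y ->
  growth a1 a2 (fun t => (y t - A t) / a2 t) T = exp (2 * RInt y 0 T).
Proof.
intros Hy; set (x := fun t => (y t - A t) / a2 t).
assert (Hx : periodic_solution (riccati a0 a1 a2) T x) by now apply solution_of_riccati_periodic.
assert (Cy : forall t, continuous y t) by (intros t; eapply is_derive_continuous, (proj2 Hy t)).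
assert (Ca : forall a t, smooth a -> continuous a t).
{ intros a t Ha; now apply (ex_derive_continuous a), smooth_ex_derive. }
assert (H : growth a1 a2 x T * a2 T
  = growth a1 a2 x 0 * a2 0 * exp (2 * RInt y 0 T - 2 * RInt y 0 0)).
{ apply (homogeneous_solution (fun t => 2 * y t) (fun t => 2 * RInt y 0 t)
    (fun t => growth a1 a2 x t * a2 t)); intros t.
  - apply (is_derive_scal (fun t => RInt y 0 t)), is_derive_primitive, Cy.
  - assert (DE : is_derive (growth a1 a2 x) t (variation a1 a2 x t * growth a1 a2 x t)).
    { apply (is_derive_growth T a0) with (3 := Hx); auto. }
    assert (D2 := Derive_correct _ _ (smooth_ex_derive _ Hs2 t)).
    auto_derive; [repeat split; eexists; eauto|].
    derive_known DE.
    change (Derive (fun x => a2 x) t) with (Derive a2 t).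
    unfold variation, x.
    replace (a1 t) with (2 * A t - Derive a2 t / a2 t) by (unfold riccati_A; field; apply Ha2).
    field; apply Ha2. }
rewrite RInt_point_R, Rmult_0_r, Rminus_0_r, growth_0 in H.
rewrite <- (Rplus_0_l T) in H at 2; rewrite Hp2 in H.
apply (Rmult_eq_reg_r (a2 0)); [|apply Ha2]; lra.
Qed.

End Reduction.

Theorem corollary4 (T : R) (a0 a1 a2 : R -> R)
  (HT : 0 < T)
  (Hs0 : smooth a0) (Hs1 : smooth a1) (Hs2 : smooth a2)
  (Hp0 : periodic T a0) (Hp1 : periodic T a1) (Hp2 : periodic T a2)
  (Ha2 : forall t, a2 t <> 0) :
  let f := riccati a0 a1 a2 in
  let gamma := riccati_gamma a0 a1 a2 in
  let Delta := discriminant T gamma in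
  (Delta > 0 ->
     exists phi1 phi2, phi1 <> phi2 /\
       (forall psi, limit_cycle f T psi <-> psi = phi1 \/ psi = phi2) /\
       hyperbolic f T phi1 /\ hyperbolic f T phi2) /\
  (Delta = 0 ->
     exists phi,
       (forall psi, limit_cycle f T psi <-> psi = phi) /\
       semi_stable f phi /\ double_cycle f T phi) /\
  (Delta < 0 -> ~ exists phi, limit_cycle f T phi) /\
  (forall p q, C1_per T p -> C1_per0 T q ->
     mu_low T gamma p - average T gamma <= Delta /\
     Delta <= mu_up T gamma q - average T gamma).
Proof.
intros f gamma Delta.
assert (C1 : forall t, continuous a1 t).
{ intros t; now apply (ex_derive_continuous a1), smooth_ex_derive. }
assert (C2 : forall t, continuous a2 t).
{ intros t; now apply (ex_derive_continuous a2), smooth_ex_derive. }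
destruct (discriminant_trichotomy T gamma HT) as [Dpos [Dzero [Dneg Dmu]]].
{ now apply riccati_gamma_periodic. }
{ now apply riccati_gamma_continuous. }
split; [|split; [|split; [|exact Dmu]]].
- intros HD; destruct (Dpos HD) as [y [Hy Hy0]].
  set (phi := fun t => (y t - riccati_A a1 a2 t) / a2 t).
  assert (Hphi : periodic_solution f T phi) by now apply solution_of_riccati_periodic.
  assert (EM : growth a1 a2 phi T <> 1).
  { unfold phi; rewrite (growth_of_solution T a0) by auto.
    rewrite <- exp_0; intros H; apply exp_inv in H; lra. }
  set (phi2 := flow a1 a2 phi ((1 - growth a1 a2 phi T) / growth_primitive a1 a2 phi T)).
  assert (Hphi2 : periodic_solution f T phi2) by now apply second_periodic_solution.
  assert (HF : growth_primitive a1 a2 phi T <> 0)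
    by now apply (growth_primitive_T_neq_0 T a0).
  assert (E2 : phi2 0 = phi 0 + (1 - growth a1 a2 phi T) / growth_primitive a1 a2 phi T)
    by apply flow_0.
  assert (Hne : phi 0 <> phi2 0).
  { intros H.
    assert (Hz : (1 - growth a1 a2 phi T) / growth_primitive a1 a2 phi T = 0) by lra.
    apply Rmult_integral in Hz; destruct Hz as [Hz|Hz]; [lra|].
    exact (Rinv_neq_0_compat _ HF Hz). }
  (* Were this multiplier [1], the period map would have [phi2 0] as its only fixed
     point. *)
  assert (EM2 : growth a1 a2 phi2 T <> 1).
  { intros H.
    destruct (periodic_solution_values T a0 a1 a2 phi2 HT C1 C2 Hphi2 phi Hphi) as [H0|H0];
      [contradiction|].
    rewrite H, Rminus_diag in H0; apply Rmult_integral in H0; destruct H0 as [H0|H0]; [lra|].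
    now apply (growth_primitive_T_neq_0 T a0 a1 a2 phi2) in H0. }
  exists phi, phi2; split; [intros E; apply Hne; exact (f_equal (fun x => x 0) E)|split; [|split]].
  + apply limit_cycles_two; [exact Hphi|exact Hphi2|exact Hne|].
    intros psi Hpsi.
    destruct (periodic_solution_values T a0 a1 a2 phi HT C1 C2 Hphi psi Hpsi) as [H|H].
    * left; now apply (periodic_solution_eq T a0 a1 a2).
    * right; apply (periodic_solution_eq T a0 a1 a2); auto.
      rewrite E2, <- H; field; exact HF.
  + now apply cycle_mult.
  + now apply cycle_mult.
- intros HD; destruct (Dzero HD) as [y [Hy Hy0]].
  set (phi := fun t => (y t - riccati_A a1 a2 t) / a2 t).
  assert (Hphi : periodic_solution f T phi) by now apply solution_of_riccati_periodic.
  assert (EM : growth a1 a2 phi T = 1).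
  { unfold phi; rewrite (growth_of_solution T a0) by auto.
    rewrite Hy0, Rmult_0_r; apply exp_0. }
  exists phi; split; [|split].
  + apply limit_cycles_one; [exact Hphi|].
    intros psi Hpsi.
    destruct (periodic_solution_values T a0 a1 a2 phi HT C1 C2 Hphi psi Hpsi) as [H|H].
    * now apply (periodic_solution_eq T a0 a1 a2).
    * rewrite EM, Rminus_diag in H; apply Rmult_integral in H; destruct H as [H|H].
      -- apply (periodic_solution_eq T a0 a1 a2); auto; lra.
      -- now apply (growth_primitive_T_neq_0 T a0 a1 a2 phi) in H.
  + exact (semi_stable_of_growth T a0 a1 a2 phi HT C1 C2 Hp1 Hp2 Ha2 Hphi EM).
  + now apply cycle_mult.
- intros HD [psi [Hpsi _]]; apply (Dneg HD).
  exists (fun t => a2 t * psi t + riccati_A a1 a2 t).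
  now apply riccati_periodic_of_solution.
Qed.
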